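(* Suppose Assumptions (a) and (b) of the context hold. Then for every Lipschitz functional $F:((\mathbb R^d)^n,d_n)\to(\mathbb R,|\cdot|)$ and every $\eta>0$, with $F_X=F(X_{t_1},\dots,X_{t_n})$, $$\mathbb E\big[\exp(\eta(F_X-\mathbb E[F_X]))\big]\le\exp\Big(\frac{16\eta^2d^2\|F\|_{\mathrm{Lip}}^2\,n\Delta_n\exp(4L\Delta_n)}{(1-\exp(-M\Delta_n))^2}\Big).$$ In addition, if $F=\frac1n\sum_{i=1}^nf(X_{t_i})$ for a Lipschitz function $f:\mathbb R^d\to\mathbb R$, then for every $\eta>0$ $$\mathbb E\Big[\exp\Big(\frac\eta n\sum_{i=1}^n(f(X_{t_i})-\mathbb E[f(X_{t_i})])\Big)\Big]\le\exp\Big(\frac{16\eta^2d^2\|f\|_{\mathrm{Lip}}^2\Delta_n\exp(4L\Delta_n)}{n(1-\exp(-M\Delta_n))^2}\Big),$$ and then, for every $r>0$, $$\mathbb P\Big(\frac1n\sum_{i=1}^n(f(X_{t_i})-\mathbb E[f(X_{t_i})])>r\Big)\le\exp\Big(\frac{-r^2n(1-\exp(-M\Delta_n))^2}{64d^2\|f\|_{\mathrm{Lip}}^2\Delta_n\exp(4L\Delta_n)}\Big).$$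
   Context: $X$ is an ergodic $d$-dimensional diffusion solving $dX_t=-b(X_t)dt+dW_t$, $t\ge0$, with $W$ a $d$-dimensional Brownian motion and $X_0$ independent of $W$. Here $b=b_{\theta_0}$, where $b_\theta=\phi_0+\sum_{j=1}^p\theta_j\phi_j$, $\phi_j:\mathbb R^d\to\mathbb R^d$, $\theta\in\Theta\subset\mathbb R^p$ ($\Theta$ compact and convex), $\theta_0\in\Theta$. $\Delta_n=T/n$ and $t_i=i\Delta_n$. (a) Every $\phi_j$, $0\le j\le p$, is Lipschitz, with constant bounded uniformly in $p$ and $d$; $L$ denotes the resulting Lipschitz constant of the drift $b=b_{\theta_0}$. (b) There is $M>0$ with $\langle b_\theta(x)-b_\theta(y),x-y\rangle\ge M\|x-y\|_2^2$ for all $x,y\in\mathbb R^d$, $\theta\in\Theta$. For $x,y\in(\mathbb R^d)^n$, $d_n(x,y)^2=\sum_{i=1}^n\|x_i-y_i\|_2^2$ and $\|F\|_{\mathrm{Lip}}=\sup_{x\ne y}|F(x)-F(y)|/d_n(x,y)$; for $f:\mathbb R^d\to\mathbb R$, $\|f\|_{\mathrm{Lip}}$ is the Lipschitz constant with respect to $\|\cdot\|_2$. *)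

(* Defs.v *)
From HB Require Import structures.
From mathcomp Require Import all_boot all_order all_algebra.
From mathcomp Require Import all_classical all_reals all_analysis.
Import Order.TTheory GRing.Theory Num.Theory.
Import numFieldNormedType.Exports.

Set Implicit Arguments.
Unset Strict Implicit.
Unset Printing Implicit Defensive.

Local Open Scope classical_set_scope.
Local Open Scope ring_scope.

(* The library norm on 'rV[R]_d is the maximum norm, hence an explicit
   Euclidean structure. *)
Definition dotp (R : realType) (d : nat) (x y : 'rV[R]_d) : R :=
  \sum_(i < d) x 0 i * y 0 i.

Definition l2norm (R : realType) (d : nat) (x : 'rV[R]_d) : R :=
  Num.sqrt (dotp x x).

Definition l2dist (R : realType) (d : nat) (x y : 'rV[R]_d) : R :=
  l2norm (x - y).

(* A point of (R^d)^n is a function 'I_n -> 'rV[R]_d. *)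
Definition dist_n (R : realType) (d n : nat) (x y : 'I_n -> 'rV[R]_d) : R :=
  Num.sqrt (\sum_(i < n) l2dist (x i) (y i) ^+ 2).

Definition lipschitz_wrt (R : realType) (U V : Type)
    (dU : U -> U -> R) (dV : V -> V -> R) (K : R) (g : U -> V) : Prop :=
  forall x y, dV (g x) (g y) <= K * dU x y.

Definition absdist (R : realType) (x y : R) : R := `|x - y|.

Definition is_lipschitz (R : realType) (U : Type) (dU : U -> U -> R)
    (F : U -> R) : Prop :=
  exists K, lipschitz_wrt dU (@absdist R) K F.

Definition lip_norm (R : realType) (U : Type) (dU : U -> U -> R)
    (F : U -> R) : R :=
  sup [set r | exists x y, x <> y /\ r = `|F x - F y| / dU x y].

Definition drift (R : realType) (d p : nat)
    (phi : 'I_p.+1 -> 'rV[R]_d -> 'rV[R]_d) (theta : 'rV[R]_p)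
    (x : 'rV[R]_d) : 'rV[R]_d :=
  phi ord0 x + \sum_(j < p) theta 0 j *: phi (lift ord0 j) x.

(* sigma(X_t, t in D), X being seen as a bare family of R^d-valued maps, so
   that the definition also applies to the coordinate process below. *)
Definition sigma_process (R : realType) (d : nat) (Om : Type)
    (D : set R) (X : R -> Om -> 'rV[R]_d) : set (set Om) :=
  <<s [set A | exists t i (B : set R),
        [/\ D t, measurable B & A = [set w | B (X t w 0 i)] ]] >>.

(* Processes are indexed by R, and only their values at times t >= 0 are
   relevant. *)
Definition is_process (R : realType) (d : nat) (dOm : measure_display)
    (Om : measurableType dOm) (X : R -> Om -> 'rV[R]_d) : Prop :=
  forall t, 0 <= t -> forall i,
    measurable_fun [set: Om] (fun w => X t w 0 i).

Definition continuous_paths (R : realType) (d : nat) (dOm : measure_display)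
    (Om : measurableType dOm) (P : probability Om R)
    (X : R -> Om -> 'rV[R]_d) : Prop :=
  {ae P, forall w, {within `[0, +oo[, continuous (fun t => X t w)}}.

Definition indep_sigma (R : realType) (dOm : measure_display)
    (Om : measurableType dOm) (P : probability Om R)
    (G H : set (set Om)) : Prop :=
  forall A B, G A -> H B -> P (A `&` B) = (P A * P B)%E.

(* The last clause says that sigma(W_u, u <= s) and the d coordinates of
   W_t - W_s are mutually independent; with the Gaussian clause, this is
   W_t - W_s ~ N(0, (t - s) I_d), independently of the past.  The second
   parameter of normal_prob is the standard deviation. *)
Definition brownian_motion (R : realType) (d : nat) (dOm : measure_display)
    (Om : measurableType dOm) (P : probability Om R)
    (W : R -> Om -> 'rV[R]_d) : Prop :=
  [/\ is_process W,
      continuous_paths P W,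
      {ae P, forall w, W 0 w = 0},
      (forall (s t : R) i (B : set R), 0 <= s -> s < t -> measurable B ->
         P [set w | B (W t w 0 i - W s w 0 i)] =
         normal_prob 0 (Num.sqrt (t - s)) B) &
      (forall (s t : R) (A : set Om) (B : 'I_d -> set R), 0 <= s -> s < t ->
         sigma_process `[0, s] W A -> (forall i, measurable (B i)) ->
         P (A `&` [set w | forall i, B i (W t w 0 i - W s w 0 i)]) =
         (P A * \prod_(i < d) P [set w | B i (W t w 0 i - W s w 0 i)%R])%E)].

(* dX_t = - b(X_t) dt + dW_t in integrated form; the noise being additive, no
   stochastic integral is involved. *)
Definition sde_solution (R : realType) (d : nat) (dOm : measure_display)
    (Om : measurableType dOm) (P : probability Om R)
    (b : 'rV[R]_d -> 'rV[R]_d) (W X : R -> Om -> 'rV[R]_d) : Prop :=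
  [/\ is_process X,
      continuous_paths P X &
      {ae P, forall w, forall t, 0 <= t -> forall i,
         X t w 0 i = X 0 w 0 i
           - \int[lebesgue_measure]_(s in `[0, t]) (b (X s w) 0 i)
           + W t w 0 i}].

(* The product sigma-algebra of the space of paths t |-> x t, t >= 0. *)
Definition path_events (R : realType) (d : nat) : set (set (R -> 'rV[R]_d)) :=
  sigma_process `[0, +oo[ (fun t (x : R -> 'rV[R]_d) => x t).

Definition shift_path (R : realType) (d : nat) (h : R) (x : R -> 'rV[R]_d) :
    R -> 'rV[R]_d :=
  fun t => x (h + t).

Definition stationary_process (R : realType) (d : nat) (dOm : measure_display)
    (Om : measurableType dOm) (P : probability Om R)
    (X : R -> Om -> 'rV[R]_d) : Prop :=
  forall h A, 0 <= h -> path_events A ->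
    P [set w | A (shift_path h (X ^~ w))] = P [set w | A (X ^~ w)].

(* An ergodic process is a stationary process whose law is trivial on
   shift-invariant events. *)
Definition ergodic_process (R : realType) (d : nat) (dOm : measure_display)
    (Om : measurableType dOm) (P : probability Om R)
    (X : R -> Om -> 'rV[R]_d) : Prop :=
  stationary_process P X /\
  forall A, path_events A ->
    (forall h, 0 <= h -> shift_path h @^-1` A = A) ->
    P [set w | A (X ^~ w)] = 0%E \/ P [set w | A (X ^~ w)] = 1%E.

(* Main.v *)
Require Import Defs.
From HB Require Import structures.
From mathcomp Require Import all_boot all_order all_algebra.
From mathcomp Require Import all_classical all_reals all_analysis.
From mathcomp Require Import measurable_realfun.
From mathcomp Require Import ring lra.
Import Order.TTheory GRing.Theory Num.Theory.
Import numFieldNormedType.Exports.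

(** The quantity estimated throughout is the product E[exp F] * E[exp(- F)]. A bound
    C on it gives E[exp(F - E F)] <= C, since E[exp(- F)] >= exp(- E F)
    ([centered_exp_moment]); unlike a centred moment, it makes sense before [F] is
    known to be integrable, and it behaves well under limits.

    The diffusion is discretized by the Euler scheme driven by the increments of
    the given Brownian motion. As the noise is additive and the drift strongly
    monotone, one step of length [h] with common noise contracts distances by
    rho = 1 - M h / 2 ([drift_step_contraction]). If [F] is Lipschitz for some gauge
    of the distances between the samples, a displacement [v] of the noise of step j
    therefore changes [F] by at most K_j |v|, where K_j is the gauge of the powers of
    rho by the numbers of steps from j to the sampling times. For one Gaussian
    noise, symmetrization, i.e. the comparison of psi(xi) / psi(xi') with
    cosh(K |xi - xi'|), bounds E[psi] E[1 / psi] by exp(d^2 K^2 h)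
    ([symmetrized_product]), and an induction on the number of steps yields the
    exponent d^2 * sum_j h K_j^2 ([chain_concentration]).

    Nothing is known on the law of X_0 except that it is invariant. By stationarity
    the sampling times may be shifted by k * Delta, which makes the dependence of
    the samples on X_0 of order exp(- M k Delta / 2); for bounded [F] it vanishes
    as k tends to infinity. Together with the pathwise convergence of the scheme
    ([euler_chain_cvg]) this proves the estimate for bounded functionals of the
    diffusion ([bounded_concentration]), and clipping removes the boundedness
    ([exp_product_of_clipped], [gauge_concentration]).

    It remains to sum the influences. With a Euclidean gauge, sum_j h K_j^2 is at
    most 2 n / M times the squared Lipschitz constant. For an empirical mean the
    gauge is a sum divided by n: one factor of K_j^2 is bounded by a geometric series
    over the sampling times, of ratio exp(- M Delta / 2), and this saves a factor n.
    As 1 - exp(- M Delta) <= M Delta, both exponents are below the stated ones, and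
    Chernoff's bound gives the deviation inequality. *)

Set Implicit Arguments.
Unset Strict Implicit.
Unset Printing Implicit Defensive.
Local Open Scope classical_set_scope.
Local Open Scope ring_scope.

(** * Measurability through finitely many coordinates *)

(** A space of states carries no sigma-algebra here: only the coordinates [c] of a
    random state are known to be measurable. This is enough for continuous
    functions, because a superlevel set of [g] is a countable union of boxes
    with rational centres. *)
Lemma measurable_coord_continuous (R : realType) d (T : measurableType d)
    (S : Type) (I : finType) (c : S -> I -> R) (g : S -> R) (Z : T -> S) :
  (forall i, measurable_fun [set: T] (fun t => c (Z t) i)) ->
  (forall s (e : R), 0 < e -> exists2 del : R, 0 < del & forall s',
     (forall i, `|c s i - c s' i| < del) -> `|g s - g s'| < e) ->
  measurable_fun [set: T] (fun t => g (Z t)).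
Proof.
move=> mc cg.
apply: (measurability (@RGenOInfty.G R)) => [|_ [_ [r ->] <-]].
  exact: RGenOInfty.measurableE.
rewrite setTI.
(* the superlevel set is the union of the rational boxes inside which g > r *)
pose good (x : {ffun I -> rat} * nat) := forall s',
  (forall i, `|ratr (x.1 i) - c s' i| < x.2.+1%:R^-1) -> r < g s'.
pose box (x : {ffun I -> rat} * nat) : set T :=
  \bigcap_(i in [set: I]) [set t | `|ratr (x.1 i) - c (Z t) i| < x.2.+1%:R^-1].
rewrite (_ : _ @^-1` _ =
    \bigcup_x (if pselect (good x) then box x else set0)); last first.
  apply/seteqP; split => [t /=|t [x _]].
  - rewrite in_itv/= andbT => rg.
    have e0 : 0 < g (Z t) - r by rewrite subr_gt0.
    have [del del0 Hd] := cg (Z t) _ e0.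
    have [k _ /(_ k (leqnn _))/= kd] :=
      near_infty_natSinv_lt (PosNum (divr_gt0 del0 (ltr0Sn R 1))).
    have Hq i : exists q : rat, `|ratr q - c (Z t) i| < k.+1%:R^-1.
      have k0 : (0 : R) < k.+1%:R^-1 by rewrite invr_gt0.
      have ck : c (Z t) i - k.+1%:R^-1 < c (Z t) i + k.+1%:R^-1.
        by rewrite ltrD2l (lt_trans _ k0)// oppr_lt0.
      have [q] := rat_in_itvoo ck.
      rewrite in_itv/= => /andP[q1 q2]; exists q.
      by rewrite ltr_distl q1/= q2.
    have [q Hq'] := choice Hq.
    exists ([ffun i => q i], k) => //.
    case: pselect => [Hg|]; last first.
      case=> s' Hs' /=.
      suff : `|g (Z t) - g s'| < g (Z t) - r by rewrite ltr_distl; lra.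
      apply: Hd => i; have := Hs' i; have := Hq' i; rewrite /= ffunE => h2 h1.
      have := ler_distD (ratr (q i)) (c (Z t) i) (c s' i).
      rewrite (distrC (c (Z t) i)) => h3; apply: le_lt_trans h3 _.
      rewrite (splitr del) ltrD ?(lt_trans h1) ?kd// distrC (lt_trans h2)//.
    by move=> i _ /=; rewrite ffunE; exact: Hq'.
  - case: pselect => // Hg Hb /=; rewrite in_itv/= andbT.
    by apply: (Hg) => i; exact: Hb.
apply: countable_bigcupT_measurable => // x.
case: pselect => [gx|ngx]; last exact: measurable0.
apply: fin_bigcap_measurable => [|i _]; first exact: finite_finset.
rewrite (_ : mkset _ = [set: T] `&`
  (fun t => `|ratr (x.1 i) - c (Z t) i|) @^-1` `]-oo, x.2.+1%:R^-1[); last first.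
  by rewrite setTI; apply/seteqP; split => t /=; rewrite in_itv.
suff : measurable_fun [set: T] (fun t => `|ratr (x.1 i) - c (Z t) i|) by apply.
by apply: measurableT_comp => //; apply: measurable_funB.
Qed.

Lemma measurable_coord_lipschitz (R : realType) d (T : measurableType d)
    (S : Type) (I : finType) (c : S -> I -> R) (g : S -> R) (Z : T -> S) (C : R) :
  (forall i, measurable_fun [set: T] (fun t => c (Z t) i)) ->
  0 <= C ->
  (forall s s', `|g s - g s'| <= C * \sum_i `|c s i - c s' i|) ->
  measurable_fun [set: T] (fun t => g (Z t)).
Proof.
move=> mc C0 gC; apply: (measurable_coord_continuous mc) => s e e0.
pose N : R := C * #|I|%:R.
have N0 : 0 <= N by rewrite mulr_ge0.
have N1 : 0 < N + 1 by lra.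
exists (e / (N + 1)) => [|s' Hs']; first exact: divr_gt0.
apply: le_lt_trans (gC s s') _.
apply: (@le_lt_trans _ _ (N * (e / (N + 1)))).
  rewrite -mulrA ler_wpM2l// mulr_natl -sumr_const ler_sum// => i _.
  exact/ltW/Hs'.
by rewrite mulrA ltr_pdivrMr// mulrC ltr_pM2l// ltrDl.
Qed.

(** * Independence as a product formula *)

Section independence.
Context (R : realType) (d : measure_display) (Om : measurableType d)
  (P : probability Om R) (G H : set (set Om)).
Hypothesis mG : G `<=` measurable.
Hypothesis mH : H `<=` measurable.
Hypothesis GH : indep_sigma P <<s G>> <<s H>>.

Lemma measurable_fun_to_generated (K : set (set Om)) :
  K `<=` measurable ->
  @measurable_fun _ _ Om (g_sigma_algebraType K) [set: Om] id.
Proof.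
move=> mK; apply: (@measurability _ _ Om (g_sigma_algebraType K) setT id K) => //.
by move=> _ [B KB <-]; rewrite setTI; apply: mK.
Qed.

Local Notation GxH :=
  (g_sigma_algebraType G * g_sigma_algebraType H)%type.

(** Independence of G and H says that the image of [P] under the diagonal is the
    product of the two restrictions of [P]; Tonelli's theorem then turns an
    expectation along the diagonal into an iterated one. *)
Lemma integral_indep (g : GxH -> \bar R) :
  measurable_fun [set: GxH] g ->
  (forall z, 0 <= g z)%E ->
  (\int[P]_w g (w, w) = \int[P]_w \int[P]_w' g (w, w'))%E.
Proof.
move=> mg g0.
have mi := measurable_fun_to_generated mG.
have mj := measurable_fun_to_generated mH.
pose fi : {mfun Om >-> g_sigma_algebraType G} := mfun_Sub (mem_set mi).
pose fj : {mfun Om >-> g_sigma_algebraType H} := mfun_Sub (mem_set mj).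
have md : measurable_fun [set: Om] (fun w => (w, w) : GxH).
  exact/measurable_fun_pair.
pose fd : {mfun Om >-> GxH} := mfun_Sub (mem_set md).
have E1 := @ge0_integral_pushforward _ _ _ _ R _ md P setT g measurableT mg
  (fun x _ => g0 x).
rewrite preimage_setT in E1.
rewrite (_ : (\int[P]_w g (w, w) = \int[pushforward P
  (fun w : Om => (w, w) : GxH)]_z g z)%E);
  last by rewrite E1.
pose PG : probability _ R := distribution P fi.
pose PH : probability _ R := distribution P fj.
have E2 X : measurable X ->
    (PG \x PH)%E X = pushforward P (fun w : Om => (w, w) : GxH) X.
  move=> mX.
  by apply: (@product_measure_unique _ _ _ _ R PG PH (distribution P fd)).
rewrite (eq_measure_integral (PG \x PH)%E); last first.
  by move=> A mA _; rewrite -[LHS]/(pushforward P _ A); exact/esym/E2.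
rewrite fubini_tonelli1// /fubini_F.
rewrite ge0_integral_distribution//; last 2 first.
- exact: (measurable_fun_fubini_tonelli_F (m2 := PH)).
- by move=> x; apply: integral_ge0.
apply: eq_integral => w _ /=.
rewrite ge0_integral_distribution//.
exact: measurable_fun_pair2.
Qed.

End independence.

(** * Euclidean geometry *)

Section euclidean.
Context (R : realType) (d : nat).
Implicit Types x y z : 'rV[R]_d.

Lemma dotpC x y : dotp x y = dotp y x.
Proof. by apply: eq_bigr => i _; rewrite mulrC. Qed.

Lemma dotpDl x y z : dotp (x + y) z = dotp x z + dotp y z.
Proof. by rewrite -big_split; apply: eq_bigr => i _; rewrite mxE mulrDl. Qed.

Lemma dotpZl (a : R) x y : dotp (a *: x) y = a * dotp x y.
Proof. by rewrite mulr_sumr; apply: eq_bigr => i _; rewrite mxE mulrA. Qed.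

Lemma dotpDr x y z : dotp x (y + z) = dotp x y + dotp x z.
Proof. by rewrite dotpC dotpDl !(dotpC x). Qed.

Lemma dotpZr (a : R) x y : dotp x (a *: y) = a * dotp x y.
Proof. by rewrite dotpC dotpZl dotpC. Qed.

Lemma dotp_ge0 x : 0 <= dotp x x.
Proof. by apply: sumr_ge0 => i _; rewrite -expr2 sqr_ge0. Qed.

Lemma l2norm_ge0 x : 0 <= l2norm x. Proof. exact: sqrtr_ge0. Qed.

Lemma l2dist_ge0 x y : 0 <= l2dist x y. Proof. exact: l2norm_ge0. Qed.

Lemma sqr_l2norm x : l2norm x ^+ 2 = dotp x x.
Proof. by rewrite sqr_sqrtr// dotp_ge0. Qed.

Lemma l2norm0 : l2norm (0 : 'rV[R]_d) = 0.
Proof. by rewrite /l2norm /dotp big1 ?sqrtr0// => i _; rewrite mxE mul0r. Qed.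

Lemma l2dist_refl x : l2dist x x = 0.
Proof. by rewrite /l2dist subrr l2norm0. Qed.

Lemma l2distC x y : l2dist x y = l2dist y x.
Proof.
rewrite /l2dist /l2norm /dotp; congr Num.sqrt; apply: eq_bigr => i _.
by rewrite !mxE; ring.
Qed.

Lemma coord_le_l2norm x i : `|x 0 i| <= l2norm x.
Proof.
rewrite -sqrtr_sqr ler_sqrt// /dotp; last exact: dotp_ge0.
rewrite (bigD1 i)//= -expr2 lerDl; apply: sumr_ge0 => j _.
by rewrite -expr2 sqr_ge0.
Qed.

Lemma l2norm_eq0 x : l2norm x = 0 -> x = 0.
Proof.
move=> x0; apply/rowP => i; rewrite mxE; apply/eqP.
by rewrite -normr_le0 -x0 coord_le_l2norm.
Qed.

Lemma l2norm_le_sum x : l2norm x <= \sum_i `|x 0 i|.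
Proof.
have S0 : 0 <= \sum_i `|x 0 i| by apply: sumr_ge0.
rewrite -[leRHS]ger0_norm// -sqrtr_sqr ler_sqrt ?sqr_ge0//.
rewrite expr2 mulr_suml; apply: ler_sum => i _.
rewrite -expr2 -real_normK ?num_real// expr2 ler_wpM2l//.
by rewrite (bigD1 i)//= lerDl sumr_ge0.
Qed.

Lemma cauchy_schwarz x y : dotp x y <= l2norm x * l2norm y.
Proof.
have [y0|y0] := eqVneq (l2norm y) 0.
  rewrite y0 mulr0 (l2norm_eq0 y0) /dotp big1// => i _.
  by rewrite mxE mulr0.
have ny : 0 < l2norm y by rewrite lt_def y0 l2norm_ge0.
set a := l2norm x; set c := l2norm y.
have : 0 <= dotp (c *: x + - a *: y) (c *: x + - a *: y) by exact: dotp_ge0.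
rewrite !(dotpDl, dotpDr, dotpZl, dotpZr) (dotpC y) -!sqr_l2norm -/a -/c => H.
have a0 : 0 <= a by exact: l2norm_ge0.
have [a00|apos] := eqVneq a 0.
  rewrite a00 mul0r (l2norm_eq0 a00) /dotp big1// => i _.
  by rewrite mxE mul0r.
have ac : 0 < c * a by rewrite mulr_gt0// lt_def apos.
rewrite -subr_ge0 -(pmulr_rge0 _ ac); nra.
Qed.

Lemma l2normD x y : l2norm (x + y) <= l2norm x + l2norm y.
Proof.
rewrite -[leRHS]ger0_norm ?addr_ge0 ?l2norm_ge0// -sqrtr_sqr ler_sqrt ?sqr_ge0//.
rewrite dotpDl !dotpDr (dotpC y) sqrrD !sqr_l2norm.
have := cauchy_schwarz x y; rewrite mulr2n; lra.
Qed.

(** Expanding the square gives the factor 1 - 2 M h + L^2 h^2 on squared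
    distances. For small [h] the last term is absorbed by half of the gain, and
    the resulting 1 - M h is at most the square of 1 - M h / 2. The noise [v] is
    common to both points and cancels. *)
Lemma drift_step_contraction (b : 'rV[R]_d -> 'rV[R]_d) (L M h : R) :
  lipschitz_wrt (@l2dist R d) (@l2dist R d) L b ->
  (forall x y, M * l2norm (x - y) ^+ 2 <= dotp (b x - b y) (x - y)) ->
  0 <= h -> L ^+ 2 * h <= M -> M * h <= 2 ->
  forall x y v, l2dist (x - h *: b x + v) (y - h *: b y + v) <=
    (1 - M * h / 2) * l2dist x y.
Proof.
move=> hL hM h0 hLM hM2 x y v.
have -> : l2dist (x - h *: b x + v) (y - h *: b y + v) =
    l2norm ((x - y) + (- h) *: (b x - b y)).
  rewrite /l2dist; congr l2norm; apply/rowP => i; rewrite !mxE; ring.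
have r0 : 0 <= 1 - M * h / 2 by lra.
rewrite -[leRHS]ger0_norm ?mulr_ge0 ?l2norm_ge0// -sqrtr_sqr.
rewrite ler_sqrt ?sqr_ge0//.
have H1 := hM x y; have := hL x y; rewrite /l2dist => H2.
move: (x - y) (b x - b y) H1 H2 => {}x {}y H1 H2.
rewrite !(dotpDl, dotpDr, dotpZl, dotpZr) (dotpC x) -!sqr_l2norm.
have := l2norm_ge0 y; have := l2norm_ge0 x.
move: (l2norm x) (l2norm y) (dotp _ _) H1 H2 => u w z H1 H2 u0 w0.
have H3 : w ^+ 2 <= L ^+ 2 * u ^+ 2.
  by rewrite -exprMn ler_sqr ?nnegrE// (le_trans w0 H2).
have H4 : h ^+ 2 * w ^+ 2 <= M * h * u ^+ 2.
  have h2 : 0 <= h ^+ 2 := sqr_ge0 _.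
  apply: (le_trans (ler_wpM2l h2 H3)).
  rewrite mulrA ler_wpM2r ?sqr_ge0// expr2 -mulrA mulrC.
  by rewrite (mulrC h) ler_wpM2r.
have H5 : 2 * h * (M * u ^+ 2) <= 2 * h * z by rewrite ler_wpM2l// mulr_ge0.
have H6 : 0 <= (M * h * u) ^+ 2 by exact: sqr_ge0.
lra.
Qed.

End euclidean.

Lemma l2norm_lipschitz (R : realType) (d : nat) (x y : 'rV[R]_d) :
  `|l2norm x - l2norm y| <= l2dist x y.
Proof.
have H (u v : 'rV[R]_d) : l2norm u - l2norm v <= l2dist u v.
  by rewrite lerBlDr; have := l2normD (u - v) v; rewrite subrK.
by rewrite ler_norml H andbT lerNl opprB l2distC.
Qed.

Lemma measurable_lipschitz_vector (R : realType) (d : nat) dT (T : measurableType dT)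
    (g : 'rV[R]_d -> R) (C : R) (Z : T -> 'rV[R]_d) : 0 <= C ->
  (forall x y, `|g x - g y| <= C * l2dist x y) ->
  (forall i, measurable_fun setT (fun t => Z t 0 i)) ->
  measurable_fun setT (fun t => g (Z t)).
Proof.
move=> C0 gC mZ.
apply: (@measurable_coord_lipschitz _ _ _ _ _
  (fun (x : 'rV[R]_d) i => x 0 i) g Z C mZ C0) => x y.
apply: le_trans (gC x y) _; rewrite ler_wpM2l// (le_trans (l2norm_le_sum _))//.
by apply: ler_sum => i _; rewrite !mxE.
Qed.

Lemma measurable_lipschitz_row (R : realType) (d : nat) dT (T : measurableType dT)
    (b : 'rV[R]_d -> 'rV[R]_d) (L : R) (Z : T -> 'rV[R]_d) :
  lipschitz_wrt (@l2dist R d) (@l2dist R d) L b ->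
  (forall j, measurable_fun [set: T] (fun t => Z t 0 j)) ->
  forall j, measurable_fun [set: T] (fun t => b (Z t) 0 j).
Proof.
move=> hL mZ j.
apply: (@measurable_lipschitz_vector _ _ _ _ (fun x => b x 0 j) `|L|) => // x y.
apply: (@le_trans _ _ (l2dist (b x) (b y))).
  by have := coord_le_l2norm (b x - b y) j; rewrite !mxE.
apply: le_trans (hL x y) _.
by rewrite ler_wpM2r ?l2dist_ge0 ?ler_norm.
Qed.

(** * Expectations of real random variables *)

Section expectations.
Context (R : realType) (d : measure_display) (Om : measurableType d)
  (P : probability Om R).

Definition L1 (f : Om -> R) := P.-integrable [set: Om] (EFin \o f).

Lemma EFin_Rintegral (f : Om -> R) : L1 f ->
  ((\int[P]_w f w)%R%:E = \int[P]_w (f w)%:E)%E.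
Proof. by move=> fi; rewrite /Rintegral fineK//; exact: integrable_fin_num. Qed.

Lemma Rintegral_probability_cst (r : R) : \int[P]_(w in [set: Om]) r = r.
Proof.
rewrite Rintegral_cst; last exact: measurableT.
transitivity (r * fine 1%E); last exact: mulr1.
by congr (_ * fine _); exact: probability_setT.
Qed.

Lemma L1_bounded (f : Om -> R) (B : R) :
  measurable_fun setT f -> (forall w, `|f w| <= B) -> L1 f.
Proof.
move=> mf fB; apply: measurable_bounded_integrable => //.
- by apply: le_lt_trans (ltry 1); exact: probability_le1.
by exists B; split => [|x Bx w _] /=; [exact: num_real|apply: le_trans (ltW Bx)].
Qed.

Lemma L1_measurable (f : Om -> R) : L1 f -> measurable_fun setT f.
Proof. by move=> /integrableP[/measurable_EFinP]. Qed.

Lemma L1D (f g : Om -> R) : L1 f -> L1 g -> L1 (fun w => f w + g w).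
Proof. by move=> /= lf lg; have := integrableD measurableT lf lg; apply. Qed.

Lemma L1Z (r : R) (f : Om -> R) : L1 f -> L1 (fun w => r * f w).
Proof. by move=> lf; have := integrableZl measurableT r lf; apply. Qed.

Lemma L1_cst (r : R) : L1 (fun=> r).
Proof. by apply: (@L1_bounded _ `|r|) => //; exact: measurable_cst. Qed.

Lemma L1_sum (I : Type) (s : seq I) (f : I -> Om -> R) :
  (forall i, L1 (f i)) -> L1 (fun w => \sum_(i <- s) f i w).
Proof.
move=> lf; elim: s => [|i s IH].
  by under [X in L1 X]funext do rewrite big_nil; exact: L1_cst.
by under [X in L1 X]funext do rewrite big_cons; exact: L1D.
Qed.

Lemma Rintegral_sum (I : Type) (s : seq I) (f : I -> Om -> R) :
  (forall i, L1 (f i)) ->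
  \int[P]_w (\sum_(i <- s) f i w) = \sum_(i <- s) \int[P]_w f i w.
Proof.
move=> lf; elim: s => [|i s IH].
  rewrite big_nil -[RHS](Rintegral_probability_cst 0).
  by apply: eq_Rintegral => w _; rewrite big_nil.
rewrite big_cons -IH -RintegralD; last 3 first.
- exact: measurableT.
- exact: lf.
- exact: L1_sum.
by apply: eq_Rintegral => w _; rewrite big_cons.
Qed.

Lemma le_expectation (f g : Om -> R) : L1 f -> L1 g ->
  (forall w, f w <= g w) -> \int[P]_w f w <= \int[P]_w g w.
Proof. by move=> lf lg fg; apply: le_Rintegral. Qed.

End expectations.

(** * Gaussian exponential moments *)

Section gaussian.
Context (R : realType) (s : R).
Hypothesis s0 : s != 0.
Local Notation mu := (@lebesgue_measure R).

(** The normal law is given by its density, which is therefore almost everywhere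
    its Radon-Nikodym derivative. *)
Lemma ge0_integral_normal_prob (m : R) (f : R -> \bar R) :
  measurable_fun setT f -> (forall x, 0 <= f x)%E ->
  (\int[normal_prob m s]_x f x = \int[mu]_x (f x * (normal_pdf m s x)%:E))%E.
Proof.
move=> mf f0.
have dom : normal_prob m s `<< mu := normal_prob_dominates m s.
rewrite -(Radon_Nikodym_SigmaFinite.change_of_variables dom)//.
have mpdf : measurable_fun setT (EFin \o normal_pdf m s).
  by apply/measurable_EFinP; exact: measurable_normal_pdf.
have iRN := Radon_Nikodym_SigmaFinite.f_integrable dom.
apply: ae_eq_integral => //.
- by apply: emeasurable_funM => //; exact: (measurable_int mu).
- exact: emeasurable_funM.
- apply: ae_eqe_mul2l => /=.
  apply: integral_ae_eq => //= E _ mE.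
  by rewrite -Radon_Nikodym_SigmaFinite.f_integral.
Qed.

(** Completing the square: an exponential factor only moves the mean. *)
Lemma normal_pdf_tilt (a x : R) :
  expR (a * x) * normal_pdf 0 s x =
  expR (a ^+ 2 * s ^+ 2 / 2) * normal_pdf (a * s ^+ 2) s x.
Proof.
rewrite !normal_pdfE// /normal_fun ![expR _ * (_ * _)]mulrCA -!expRD.
congr (_ * expR _); rewrite -mulr_natr; field; exact: s0.
Qed.

Lemma normal_mgf (a : R) :
  (\int[normal_prob 0 s]_x (expR (a * x))%:E =
   (expR (a ^+ 2 * s ^+ 2 / 2))%:E)%E.
Proof.
rewrite ge0_integral_normal_prob; last 2 first.
- apply/measurable_EFinP; apply: measurableT_comp => //; exact: measurable_funM.
- by move=> x; rewrite lee_fin expR_ge0.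
under eq_integral do rewrite -EFinM normal_pdf_tilt EFinM.
rewrite ge0_integralZl//.
- by rewrite integral_normal_pdf mule1.
- by apply/measurable_EFinP; exact: measurable_normal_pdf.
- by move=> x _; rewrite lee_fin normal_pdf_ge0.
Qed.

Lemma normal_variable_mgf d (Om : measurableType d) (P : probability Om R)
    (xi : Om -> R) (a : R) :
  measurable_fun setT xi ->
  (forall B, measurable B -> P (xi @^-1` B) = normal_prob 0 s B) ->
  (\int[P]_w (expR (a * xi w))%:E = (expR (a ^+ 2 * s ^+ 2 / 2))%:E)%E.
Proof.
move=> mxi lawxi; rewrite -normal_mgf.
have mxi' : @measurable_fun _ _ Om (measurableTypeR R) setT xi by exact: mxi.
have me : @measurable_fun _ _ (measurableTypeR R) _ setT
    (fun x : measurableTypeR R => (expR (a * x))%:E).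
  apply/measurable_EFinP; apply: measurableT_comp => //; exact: measurable_funM.
pose X : {mfun Om >-> measurableTypeR R} :=
  @mfun_Sub _ _ Om (measurableTypeR R) xi (mem_set mxi').
rewrite -[LHS](@ge0_integral_distribution _ _ _ _ R P X
  (fun x => (expR (a * x))%:E))//.
by apply: eq_measure_integral => B mB _; exact: lawxi.
Qed.

End gaussian.

(** * Symmetrization *)

(** Jensen's inequality for the exponential, from its tangent line at the mean. *)
Lemma expR_sum_le (R : realType) (d : nat) (u : 'I_d -> R) : (0 < d)%N ->
  expR (\sum_i u i) <= d%:R^-1 * \sum_i expR (d%:R * u i).
Proof.
move=> d0; set S := \sum_i u i.
have dR : (0 : R) < d%:R by rewrite ltr0n.
have H i : expR S * (1 + (d%:R * u i - S)) <= expR (d%:R * u i).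
  apply: (@le_trans _ _ (expR S * expR (d%:R * u i - S))).
    by rewrite ler_wpM2l ?expR_ge0// expR_ge1Dx.
  by rewrite -expRD addrC subrK.
rewrite ler_pdivlMl//; apply: le_trans (ler_sum _ (fun i _ => H i)).
rewrite -mulr_sumr big_split/= sumrB -mulr_sumr -/S !sumr_const card_ord.
by rewrite -[S *+ d]mulr_natl subrr addr0 mulrC.
Qed.

Section symmetrization.
Context (R : realType) (dOm : measure_display) (Om : measurableType dOm)
  (P : probability Om R) (d : nat) (xi : Om -> 'I_d -> R) (v kappa B : R)
  (psi : Om -> R).
Hypothesis mxi : forall i, measurable_fun setT (fun w => xi w i).
Hypothesis mgf : forall i a,
  (\int[P]_w (expR (a * xi w i))%:E = (expR (a ^+ 2 * v / 2))%:E)%E.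
Hypothesis kappa0 : 0 <= kappa.
Hypothesis mpsi : measurable_fun setT psi.
Hypothesis psi_lo : forall w, expR (- B) <= psi w.
Hypothesis psi_up : forall w, psi w <= expR B.
Hypothesis psi_lip : forall w w',
  psi w <= psi w' * expR (kappa * \sum_i `|xi w i - xi w' i|).

Let psi_gt0 w : 0 < psi w. Proof. exact: lt_le_trans (expR_gt0 _) (psi_lo w). Qed.

Let L1psi : L1 P psi.
Proof.
apply: (@L1_bounded _ _ _ _ _ (expR B)) => // w.
by rewrite gtr0_norm.
Qed.

Let L1psiV : L1 P (fun w => (psi w)^-1).
Proof.
apply: (@L1_bounded _ _ _ _ _ (expR B)) => [|w].
  rewrite (_ : (fun w => _) = fun w => expR (- ln (psi w))); last first.
    by apply/funext => w; rewrite expRN lnK// posrE.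
  apply: measurableT_comp => //; apply: measurableT_comp => //.
  by apply: measurableT_comp => //; exact: measurable_ln.
rewrite gtr0_norm ?invr_gt0// -[expR B]invrK lef_pV2 ?posrE ?invr_gt0 ?expR_gt0//.
by rewrite -expRN.
Qed.

Let L1exp i a : L1 P (fun w => expR (a * xi w i)).
Proof.
apply/integrableP; split.
  apply/measurable_EFinP; apply: measurableT_comp => //.
  exact: measurable_funM.
under eq_integral do rewrite /= ger0_norm ?expR_ge0//.
by rewrite mgf ltry.
Qed.

Let Eexp i a : \int[P]_w expR (a * xi w i) = expR (a ^+ 2 * v / 2).
Proof. by rewrite /Rintegral mgf. Qed.

(** The product is the expectation of psi(xi) / psi(xi'), where xi' is an
    independent copy of xi. Exchanging xi and xi' replaces the ratio x by
    (x + 1/x) / 2, which is at most cosh(kappa * |xi - xi'|_1) as x lies between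
    exp(- t) and exp t for t = kappa * |xi - xi'|_1. Convexity of cosh splits the
    sum over the coordinates at the price of a factor [d] in the argument, and
    what remains are products of exponential moments of single coordinates. *)
Lemma symmetrized_product :
  (\int[P]_w psi w) * (\int[P]_w (psi w)^-1) <=
  expR (kappa ^+ 2 * d%:R ^+ 2 * v).
Proof.
have [d0|d_gt0] := posnP d.
  have psiE w : psi w = psi point.
    apply/eqP; rewrite eq_le; apply/andP; split.
    - rewrite (le_trans (psi_lip _ point))// big1 ?mulr0 ?expR0 ?mulr1// => i.
      by have := ltn_ord i; rewrite {2}d0.
    - rewrite (le_trans (psi_lip _ w))// big1 ?mulr0 ?expR0 ?mulr1// => i.
      by have := ltn_ord i; rewrite {2}d0.
  under eq_Rintegral do rewrite psiE.
  under [X in _ * X]eq_Rintegral do rewrite psiE.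
  rewrite !Rintegral_probability_cst mulfV ?gt_eqF//.
  by rewrite [in leRHS]d0 expr0n/= mulr0 mul0r expR0.
set A := (X in X * _); set A' := (X in _ * X).
pose a := d%:R * kappa.
pose m := expR (a ^+ 2 * v / 2).
(* [step] is the expectation over the copy w' with w fixed; by symmetry only the
   two numbers A and A' occur, so that no integral has to be exchanged *)
have step w : A * (psi w)^-1 + psi w * A' <=
    d%:R^-1 * \sum_i (expR (a * xi w i) * m + expR (- a * xi w i) * m).
  have L1a : L1 P (fun w' => (psi w)^-1 * psi w') by exact: L1Z.
  have L1b : L1 P (fun w' => psi w * (psi w')^-1) by exact: L1Z.
  rewrite [leLHS](_ : _ =
      \int[P]_w' ((psi w)^-1 * psi w' + psi w * (psi w')^-1)); last first.
    rewrite RintegralD//; congr (_ + _); last by rewrite RintegralZl.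
    by rewrite (RintegralZl _ _ L1psi)// mulrC.
  rewrite [leRHS](_ : _ = \int[P]_w' (d%:R^-1 * \sum_i
     (expR (a * xi w i) * expR (- a * xi w' i) +
      expR (- a * xi w i) * expR (a * xi w' i)))); last first.
    rewrite RintegralZl//; last first.
      by apply: L1_sum => i; apply: L1D; apply: L1Z.
    congr (_ * _); rewrite Rintegral_sum; last by move=> i; apply: L1D; apply: L1Z.
    apply: eq_bigr => i _.
    rewrite RintegralD//; last 2 first.
    - exact: L1Z.
    - exact: L1Z.
    by rewrite !(RintegralZl _ _ (L1exp _ _))// !Eexp sqrrN.
  apply: le_expectation.
  - exact: L1D.
  - by apply: L1Z; apply: L1_sum => i; apply: L1D; apply: L1Z.
  move=> w'.
  set t := kappa * \sum_i `|xi w i - xi w' i|.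
  have t1 : psi w <= psi w' * expR t by exact: psi_lip.
  have t2 : psi w' <= psi w * expR t.
    rewrite (le_trans (psi_lip _ w))//; under eq_bigr do rewrite distrC.
    by rewrite lexx.
  set x := (psi w)^-1 * psi w'.
  have x0 : 0 < x by rewrite mulr_gt0// invr_gt0.
  have -> : psi w * (psi w')^-1 = x^-1 by rewrite invfM invrK.
  have x1 : x <= expR t by rewrite ler_pdivrMl.
  have x2 : x^-1 <= expR t by rewrite invfM invrK ler_pdivrMr// mulrC.
  apply: (@le_trans _ _ (expR t + expR (- t))).
    rewrite expRN.
    have e0 := expR_gt0 t; move: (expR t) e0 x1 x2 => c c0 x1 x2.
    have : 0 <= (c - x) * (1 - x^-1 * c^-1).
      apply: mulr_ge0; first by rewrite subr_ge0.
      by rewrite subr_ge0 ler_pdivrMr// mul1r.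
    have cc : c * c^-1 = 1 by rewrite mulfV// gt_eqF.
    have xx : x * x^-1 = 1 by rewrite mulfV// gt_eqF.
    rewrite mulrBr mulr1 [X in _ - X]mulrBl mulrCA cc mulr1 mulrA xx mul1r.
    lra.
  have absE i : expR (a * `|xi w i - xi w' i|) + expR (- (a * `|xi w i - xi w' i|))
      = expR (a * xi w i) * expR (- a * xi w' i) +
      expR (- a * xi w i) * expR (a * xi w' i).
    rewrite -!expRD !mulNr -!mulrBr [- _ + _]addrC -mulrBr.
    have -> : a * (xi w' i - xi w i) = - (a * (xi w i - xi w' i)).
      by rewrite -mulrN opprB.
    by have [h|h] := ger0P (xi w i - xi w' i); rewrite // mulrN opprK addrC.
  under eq_bigr do rewrite -absE.
  have tE : t = \sum_i kappa * `|xi w i - xi w' i| by rewrite /t mulr_sumr.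
  rewrite big_split/= mulrDr lerD//.
  - rewrite tE; apply: le_trans (expR_sum_le _ d_gt0) _.
    by rewrite ler_wpM2l// ler_sum// => i _; rewrite mulrA.
  - rewrite tE -sumrN; apply: le_trans (expR_sum_le _ d_gt0) _.
    by rewrite ler_wpM2l// ler_sum// => i _; rewrite mulrN mulrA.
have L1s : L1 P (fun w => A * (psi w)^-1 + psi w * A').
  rewrite (_ : (fun w => _) = (fun w => A * (psi w)^-1 + A' * psi w)).
    by apply: L1D; apply: L1Z.
  by apply/funext => w; rewrite (mulrC A').
have L1r i a' : L1 P (fun w => expR (a' * xi w i) * m).
  rewrite (_ : (fun w => _) = (fun w => m * expR (a' * xi w i))); first exact: L1Z.
  by apply/funext => w; rewrite mulrC.
have : \int[P]_w (A * (psi w)^-1 + psi w * A') <= \int[P]_w (d%:R^-1 *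
   \sum_i (expR (a * xi w i) * m + expR (- a * xi w i) * m)).
  apply: le_expectation => //; apply: L1Z; apply: L1_sum => i.
  exact: L1D.
rewrite RintegralD//; last 2 first.
- exact: L1Z.
- rewrite (_ : (_ \o _) = EFin \o (fun w => A' * psi w)); first exact: L1Z.
  by apply/funext => w; rewrite /= mulrC.
rewrite RintegralZl// RintegralZr// -/A -/A'.
rewrite RintegralZl//; last first.
  by apply: L1_sum => i; apply: L1D.
rewrite Rintegral_sum; last by move=> i; apply: L1D.
under eq_bigr => i _.
  rewrite RintegralD//; try exact: L1r.
  rewrite !(RintegralZr _ _ (L1exp _ _))// !Eexp sqrrN -/m.
  over.
rewrite sumr_const card_ord -[X in _ <= _ * X]mulr_natl mulKf ?pnatr_eq0 -?lt0n//.
have -> : m * m = expR (kappa ^+ 2 * d%:R ^+ 2 * v).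
  by rewrite /m -expRD; congr expR; rewrite /a; field.
lra.
Qed.

End symmetrization.

(** * Gauges and the Euler chain *)

(** A gauge measures the vector of the distances between the components of two
    states; Lipschitz functionals of the samples are Lipschitz for a Euclidean
    gauge, and empirical means for a weighted sum, which is what distinguishes
    the two concentration rates. *)
Definition gauge (R : realType) (n : nat) (Nm : ('I_n -> R) -> R) :=
  (forall u v, (forall i, 0 <= u i <= v i) -> Nm u <= Nm v) /\
  (forall c u, 0 <= c -> Nm (fun i => c * u i) = c * Nm u).

Section gauge.
Context (R : realType) (n : nat) (Nm : ('I_n -> R) -> R).
Hypothesis gNm : gauge Nm.

Lemma gauge_ge0 u : (forall i, 0 <= u i) -> 0 <= Nm u.
Proof.
case: gNm => mono homo u0.
rewrite -[X in X <= _](mul0r (Nm u)) -homo//; apply: mono => i.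
by rewrite mul0r lexx u0.
Qed.

Lemma gauge_le_cst u (c : R) : 0 <= c -> (forall i, 0 <= u i <= c) ->
  Nm u <= c * Nm (fun=> 1).
Proof.
case: gNm => mono homo c0 uc; rewrite -homo//; apply: mono => i.
by rewrite mulr1.
Qed.

Lemma measurable_gauge_lipschitz (d : nat) dT (T : measurableType dT)
    (g : ('I_n -> 'rV[R]_d) -> R) (Z : T -> 'I_n -> 'rV[R]_d) :
  (forall s s', `|g s - g s'| <= Nm (fun i => l2dist (s i) (s' i))) ->
  (forall i j, measurable_fun [set: T] (fun t => Z t i 0 j)) ->
  measurable_fun [set: T] (fun t => g (Z t)).
Proof.
move=> gl mZ.
apply: (@measurable_coord_lipschitz _ _ _ _ ('I_n * 'I_d)%type
  (fun (s : 'I_n -> 'rV[R]_d) ij => s ij.1 0 ij.2) g Z (Nm (fun=> 1))) => //.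
- by apply: (gauge_ge0 (u := fun=> 1)) => i; exact: ler01.
- move=> s s'; apply: le_trans (gl s s') _; rewrite mulrC.
  apply: gauge_le_cst => [|i]; first by rewrite sumr_ge0.
  rewrite l2dist_ge0/= (le_trans (l2norm_le_sum _))//.
  rewrite -(pair_bigA_idem _ (fun i j => `|s i 0 j - s' i 0 j|))/=; last by rewrite addr0.
  rewrite (bigD1 i)//= -[leLHS]addr0 lerD//.
    by rewrite ler_sum// => j _; rewrite !mxE.
  by rewrite sumr_ge0// => k _; rewrite sumr_ge0.
Qed.

End gauge.

Section chain.
Context (R : realType) (d n : nat) (b : 'rV[R]_d -> 'rV[R]_d) (h rho : R)
  (m : 'I_n -> nat) (Nm : ('I_n -> R) -> R).
Local Notation state := ('I_n -> 'rV[R]_d).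
Hypothesis gNm : gauge Nm.
Hypothesis rho0 : 0 <= rho.
Hypothesis rho1 : rho <= 1.
Hypothesis contraction : forall x y v,
  l2dist (x - h *: b x + v) (y - h *: b y + v) <= rho * l2dist x y.

(** The state records the chain at each of the [n] sampling steps [m i]: a
    component follows the Euler scheme until its sampling step and is frozen
    afterwards. A functional of the samples is thus a function of the final
    state, and the chain of states is Markov. *)
Definition euler_step (j : nat) (s : state) (v : 'rV[R]_d) : state :=
  fun i => if (j < m i)%N then s i - h *: b (s i) + v else s i.

Fixpoint euler_chain (xi : nat -> 'rV[R]_d) (s : state) (J : nat) : state :=
  if J is J'.+1 then euler_step J' (euler_chain xi s J') (xi J') else s.

(** The distance at step [j] that controls the gauge of the final states: component
    [i] will still be contracted m i - j times, and not at all once frozen, the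
    subtraction being truncated. *)
Definition gap (j : nat) (s s' : state) : R :=
  Nm (fun i => rho ^+ (m i - j) * l2dist (s i) (s' i)).

(** How much the final state can move, in the gauge, per unit of displacement of
    the noise of step [j]. *)
Definition influence (j : nat) : R :=
  Nm (fun i => if (j < m i)%N then rho ^+ (m i - j.+1) else 0).

Lemma influence_ge0 j : 0 <= influence j.
Proof. by apply: gauge_ge0 => // i; case: ifP => // _; rewrite exprn_ge0. Qed.

Lemma gap_sym j s s' : gap j s s' = gap j s' s.
Proof. by congr Nm; apply/funext => i; rewrite l2distC. Qed.

Lemma gap_le j s s' : gap j s s' <= Nm (fun i => l2dist (s i) (s' i)).
Proof.
apply: gNm.1 => i.
by rewrite mulr_ge0 ?exprn_ge0 ?l2dist_ge0//= ler_piMl ?l2dist_ge0 ?exprn_ile1.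
Qed.

Lemma gap_step j s s' v :
  gap j.+1 (euler_step j s v) (euler_step j s' v) <= gap j s s'.
Proof.
apply: gNm.1 => i; rewrite mulr_ge0 ?exprn_ge0 ?l2dist_ge0//= /euler_step.
case: ltnP => jm; last first.
  have -> : (m i - j.+1 = 0)%N by apply/eqP; rewrite subn_eq0 leqW.
  by have -> : (m i - j = 0)%N by apply/eqP; rewrite subn_eq0.
rewrite (_ : m i - j = (m i - j.+1).+1)%N; last by rewrite subnSK.
by rewrite exprSr -mulrA ler_wpM2l ?exprn_ge0.
Qed.

Lemma gap_noise j s v v' :
  gap j.+1 (euler_step j s v) (euler_step j s v') <= influence j * l2dist v v'.
Proof.
rewrite mulrC /influence -gNm.2 ?l2dist_ge0//; apply: gNm.1 => i.
rewrite mulr_ge0 ?exprn_ge0 ?l2dist_ge0//= /euler_step.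
case: ifP => _; last by rewrite l2dist_refl mulr0 mulr0.
rewrite mulrC; apply: ler_wpM2r; first by rewrite exprn_ge0.
rewrite /l2dist le_eqVlt; apply/orP; left; apply/eqP; congr l2norm.
by apply/rowP => k; rewrite !mxE; ring.
Qed.

Lemma gap_chain xi s s' J :
  gap J (euler_chain xi s J) (euler_chain xi s' J) <= gap 0 s s'.
Proof. by elim: J => // J IH; exact: le_trans (gap_step _ _ _ _) IH. Qed.

Section observable.
Context (B : R).

(** The class of functions of the state that is stable under averaging over the
    noise of one step, and under inversion. *)
Definition log_lipschitz (j : nat) (V : state -> R) :=
  (forall s, expR (- B) <= V s <= expR B) /\
  (forall s s', V s <= V s' * expR (gap j s s')).

Lemma log_lipschitz_gt0 j V s : log_lipschitz j V -> 0 < V s.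
Proof. by case=> /(_ s)/andP[+ _] _; apply: lt_le_trans; exact: expR_gt0. Qed.

Lemma log_lipschitzV j V : log_lipschitz j V -> log_lipschitz j (fun s => (V s)^-1).
Proof.
move=> lV; have V0 s := log_lipschitz_gt0 s lV; case: lV => Vb Vl.
split => [s|s s'].
- have /andP[V1 V2] := Vb s; apply/andP; split.
    by rewrite expRN lef_pV2 ?posrE ?expR_gt0.
  by rewrite -[expR B]invrK -expRN lef_pV2 ?posrE ?expR_gt0.
- rewrite -ler_pdivrMr ?expR_gt0// -invfM lef_pV2 ?posrE ?mulr_gt0 ?expR_gt0//.
  by rewrite gap_sym; exact: Vl.
Qed.

End observable.

End chain.

(** * Concentration for the Euler chain *)

Section chain_measurability.
Context (R : realType) (d n : nat) (b : 'rV[R]_d -> 'rV[R]_d) (h L : R)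
  (m : 'I_n -> nat).
Hypothesis bL : lipschitz_wrt (@l2dist R d) (@l2dist R d) L b.
Context dT (T : measurableType dT).

Lemma measurable_euler_step (Z : T -> 'I_n -> 'rV[R]_d) (v : T -> 'rV[R]_d) J :
  (forall i k, measurable_fun setT (fun t => Z t i 0 k)) ->
  (forall k, measurable_fun setT (fun t => v t 0 k)) ->
  forall i k, measurable_fun setT (fun t => euler_step b h m J (Z t) (v t) i 0 k).
Proof.
move=> mZ mv i k; rewrite /euler_step; case: (J < m i)%N => //.
rewrite (_ : (fun t => _) = fun t => Z t i 0 k - h * b (Z t i) 0 k + v t 0 k).
  apply: measurable_funD => //; apply: measurable_funB => //.
  by apply: measurable_funM => //; exact: (measurable_lipschitz_row bL).
by apply/funext => t; rewrite !mxE.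
Qed.

Lemma measurable_euler_chain (xi : nat -> T -> 'rV[R]_d) (Z : T -> 'I_n -> 'rV[R]_d) J :
  (forall i k, measurable_fun setT (fun t => Z t i 0 k)) ->
  (forall j k, (j < J)%N -> measurable_fun setT (fun t => xi j t 0 k)) ->
  forall i k, measurable_fun setT
    (fun t => euler_chain b h m (xi ^~ t) (Z t) J i 0 k).
Proof.
move=> mZ; elim: J => [//|J IH] mxi /=.
apply: (@measurable_euler_step (fun t => euler_chain b h m (xi ^~ t) (Z t) J)).
  by apply: IH => j k jJ; apply: mxi; rewrite leqW.
by move=> k; exact: mxi.
Qed.

End chain_measurability.

Section chain_concentration.
Context (R : realType) (d n : nat) (b : 'rV[R]_d -> 'rV[R]_d) (h rho L : R)
  (m : 'I_n -> nat) (Nm : ('I_n -> R) -> R).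
Local Notation state := ('I_n -> 'rV[R]_d).
Hypothesis gNm : gauge Nm.
Hypothesis rho0 : 0 <= rho.
Hypothesis rho1 : rho <= 1.
Hypothesis contraction : forall x y v,
  l2dist (x - h *: b x + v) (y - h *: b y + v) <= rho * l2dist x y.
Hypothesis bL : lipschitz_wrt (@l2dist R d) (@l2dist R d) L b.
Context (dOm : measure_display) (Om : measurableType dOm)
  (P : probability Om R) (xi : nat -> Om -> 'rV[R]_d) (B : R).

Definition past (J : nat) : set (set Om) :=
  [set A | exists j i (U : set R),
     [/\ (j < J)%N, measurable U & A = [set w | U (xi j w 0 i)]]].

Definition present (J : nat) : set (set Om) :=
  [set A | exists i (U : set R), measurable U /\ A = [set w | U (xi J w 0 i)]].

Hypothesis mxi : forall j i, measurable_fun setT (fun w => xi j w 0 i).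
Hypothesis indep : forall J, indep_sigma P <<s past J>> <<s present J>>.
Hypothesis mgf : forall j i a,
  (\int[P]_w (expR (a * xi j w 0 i))%:E = (expR (a ^+ 2 * h / 2))%:E)%E.

Local Notation past_present J :=
  (g_sigma_algebraType (past J) * g_sigma_algebraType (present J))%type.
Local Notation step := (euler_step b h m).
Local Notation chain s J w := (euler_chain b h m (xi ^~ w) s J).
Local Notation loglip := (log_lipschitz rho m Nm B).

Lemma log_lipschitz_measurable dT (T : measurableType dT) j V (Z : T -> state) :
  loglip j V ->
  (forall i k, measurable_fun setT (fun t => Z t i 0 k)) ->
  measurable_fun setT (fun t => V (Z t)).
Proof.
move=> lV mZ; have V0 s := log_lipschitz_gt0 s lV; have [Vb Vl] := lV.
rewrite (_ : (fun t => _) = fun t => expR (ln (V (Z t)))); last first.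
  by apply/funext => t; rewrite lnK// posrE.
apply: measurableT_comp => //.
apply: (measurable_gauge_lipschitz gNm (g := fun s => ln (V s))) => // s s'.
have H s1 s2 : ln (V s1) - ln (V s2) <= Nm (fun i => l2dist (s1 i) (s2 i)).
  apply: le_trans (gap_le m gNm rho0 rho1 j s1 s2).
  rewrite lerBlDl -(ler_expR (ln (V s1))) expRD !lnK ?posrE//.
rewrite ler_norml lerNl opprB H andbT (le_trans (H s' s))//.
rewrite le_eqVlt; apply/orP; left; apply/eqP; congr Nm.
by apply/funext => i; rewrite l2distC.
Qed.

Lemma log_lipschitz_L1 j V (Z : Om -> state) :
  loglip j V ->
  (forall i k, measurable_fun setT (fun t => Z t i 0 k)) ->
  L1 P (fun t => V (Z t)).
Proof.
move=> lV mZ; apply: (@L1_bounded _ _ _ _ _ (expR B)).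
  exact: log_lipschitz_measurable lV mZ.
move=> w; rewrite gtr0_norm ?(log_lipschitz_gt0 _ lV)//.
by have [/(_ (Z w))/andP[]] := lV.
Qed.

Definition average (J : nat) (V : state -> R) (s : state) : R :=
  \int[P]_w V (step J s (xi J w)).

Let mstep J s i k : measurable_fun setT (fun w => step J s (xi J w) i 0 k).
Proof. by apply: (@measurable_euler_step _ _ _ b h L m bL _ _ (fun=> s)). Qed.

(** Two states that receive the same noise do not move apart for [gap], so averaging
    over it does not spoil the modulus of log-continuity. *)
Lemma average_log_lipschitz J V : loglip J.+1 V -> loglip J (average J V).
Proof.
move=> lV; have l1 s := log_lipschitz_L1 lV (mstep J s).
have [Vb Vl] := lV; split => [s|s s'].
- apply/andP; split.
  + rewrite -(Rintegral_probability_cst P (expR (- B))).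
    apply: le_expectation => [||w]; [exact: L1_cst|exact: l1|].
    by have /andP[] := Vb (step J s (xi J w)).
  + rewrite -(Rintegral_probability_cst P (expR B)).
    apply: le_expectation => [||w]; [exact: l1|exact: L1_cst|].
    by have /andP[] := Vb (step J s (xi J w)).
- rewrite mulrC -(RintegralZl _ _ (l1 s'))//; apply: le_expectation => [||w].
  + exact: l1.
  + exact: L1Z.
  + apply: le_trans (Vl _ (step J s' (xi J w))) _; rewrite mulrC ler_wpM2r//.
      exact/ltW/(log_lipschitz_gt0 _ lV).
    by rewrite ler_expR gap_step.
Qed.

Let measurable_past J j i : (j < J)%N ->
  @measurable_fun _ _ (g_sigma_algebraType (past J)) _ setT (fun w => xi j w 0 i).
Proof.
by move=> jJ _ U mU; rewrite setTI; apply: sub_sigma_algebra; exists j, i, U.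
Qed.

Let measurable_present J i :
  @measurable_fun _ _ (g_sigma_algebraType (present J)) _ setT (fun w => xi J w 0 i).
Proof.
by move=> _ U mU; rewrite setTI; apply: sub_sigma_algebra; exists i, U.
Qed.

Let mchain s J i k : measurable_fun setT (fun w => chain s J w i 0 k).
Proof. by apply: (@measurable_euler_chain _ _ _ b h L m bL _ _ xi (fun=> s)). Qed.

Lemma expectation_chainS s J V : loglip J.+1 V ->
  \int[P]_w V (chain s J.+1 w) = \int[P]_w average J V (chain s J w).
Proof.
move=> lV; congr fine.
pose g (z : past_present J) : \bar R :=
  (V (step J (chain s J z.1) (xi J z.2)))%:E.
have gE := @integral_indep R dOm Om P (past J) (present J) _ _ (@indep J) g.
rewrite /= in gE; rewrite gE.
- apply: eq_integral => w _ ; rewrite /average EFin_Rintegral//.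
  exact: log_lipschitz_L1 lV (mstep J _).
- move=> A [j [i [U [jJ mU ->]]]].
  by have := mxi j i measurableT mU; rewrite setTI.
- move=> A [i [U [mU ->]]].
  by have := mxi J i measurableT mU; rewrite setTI.
- apply/measurable_EFinP.
  apply: (log_lipschitz_measurable (Z := fun z : past_present J =>
     step J (chain s J z.1) (xi J z.2)) lV) => i k.
  apply: (@measurable_euler_step _ _ _ b h L m bL _ _
    (fun z : past_present J => chain s J z.1)
    (fun z : past_present J => xi J z.2)) => [i' k'|k'].
    apply: (measurableT_comp
      (f := fun w : g_sigma_algebraType (past J) => chain s J w i' 0 k')) => //.
    apply: (@measurable_euler_chain _ _ _ b h L m bL _
      (g_sigma_algebraType (past J)) xi (fun=> s)) => // j k'' jJ.
    exact: measurable_past.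
  by apply: (measurableT_comp
    (f := fun w : g_sigma_algebraType (present J) => xi J w 0 k')).
- by move=> z; rewrite lee_fin ltW// (log_lipschitz_gt0 _ lV).
Qed.

(** Induction on the number of steps. Averaging the last noise turns [V] into
    another log-Lipschitz function, and [1 / V] into a function that, by
    symmetrization, exceeds the inverse of the first one by at most a factor
    exp(d^2 h K_J^2), where K_J is the influence of that noise. *)
Theorem chain_concentration J V s : loglip J V ->
  (\int[P]_w V (chain s J w)) * (\int[P]_w (V (chain s J w))^-1) <=
  expR (d%:R ^+ 2 * \sum_(j < J) (h * influence rho m Nm j ^+ 2)).
Proof.
elim: J V => [|J IH] V lV.
  have V0 := log_lipschitz_gt0 s lV.
  by rewrite /= !Rintegral_probability_cst mulfV ?gt_eqF// big_ord0 mulr0 expR0.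
have lVV := log_lipschitzV lV.
have lA := average_log_lipschitz lV.
have lAV := log_lipschitzV lA.
rewrite (expectation_chainS s lV) (expectation_chainS s lVV) big_ord_recr/=.
set K := influence rho m Nm J.
set c := expR (d%:R ^+ 2 * (h * K ^+ 2)).
have key s' : average J (fun x => (V x)^-1) s' <= c * (average J V s')^-1.
  rewrite ler_pdivlMr ?(log_lipschitz_gt0 _ lA)// mulrC.
  rewrite (_ : c = expR (K ^+ 2 * d%:R ^+ 2 * h)); last first.
    by congr expR; ring.
  apply: (@symmetrized_product _ _ _ P d (fun w i => xi J w 0 i) h K B
     (fun w => V (step J s' (xi J w)))) => //.
  - exact: log_lipschitz_measurable lV (mstep J s').
  - by move=> w; have [/(_ (step J s' (xi J w)))/andP[]] := lV.
  - by move=> w; have [/(_ (step J s' (xi J w)))/andP[]] := lV.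
  - move=> w w'; have [_ Vl] := lV; apply: le_trans (Vl _ (step J s' (xi J w'))) _.
    rewrite ler_wpM2l ?ler_expR ?(ltW (log_lipschitz_gt0 _ lV))//.
    rewrite (le_trans (gap_noise _ _ _ gNm rho0 _ _ _ _))//.
    rewrite ler_wpM2l ?influence_ge0//.
    apply: le_trans (l2norm_le_sum _) _.
    by apply: ler_sum => i _; rewrite !mxE.
have L1A := log_lipschitz_L1 lA (mchain s J).
have L1AV := log_lipschitz_L1 lAV (mchain s J).
have A0 : 0 <= \int[P]_w average J V (chain s J w).
  by apply: Rintegral_ge0 => w _; exact/ltW/(log_lipschitz_gt0 _ lA).
apply: (@le_trans _ _ ((\int[P]_w average J V (chain s J w)) *
   (c * \int[P]_w (average J V (chain s J w))^-1))).
  rewrite ler_wpM2l// -RintegralZl//; apply: le_expectation.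
  - exact: log_lipschitz_L1 (average_log_lipschitz lVV) (mchain s J).
  - exact: L1Z.
  - by move=> w; exact: key.
by rewrite mulrCA mulrDr expRD mulrC -/c ler_wpM2r ?expR_ge0//; exact: IH.
Qed.

End chain_concentration.

(** * Brownian increments *)

Definition process_events (R : realType) (d : nat) (Om : Type) (D : set R)
    (X : R -> Om -> 'rV[R]_d) : set (set Om) :=
  [set A | exists t i (B : set R),
     [/\ D t, measurable B & A = [set w | B (X t w 0 i)] ]].

Lemma measurable_generated_process (R : realType) (d : nat) (Om : pointedType)
    (D : set R) (X : R -> Om -> 'rV[R]_d) t i : D t ->
  @measurable_fun _ _ (g_sigma_algebraType (process_events D X)) _
    setT (fun w => X t w 0 i).
Proof.
by move=> Dt _ B mB; rewrite setTI; apply: sub_sigma_algebra; exists t, i, B.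
Qed.

Section brownian_noise.
Context (R : realType) (d : nat) (dOm : measure_display)
  (Om : measurableType dOm) (P : probability Om R) (W : R -> Om -> 'rV[R]_d).
Hypothesis hW : brownian_motion P W.

Lemma measurable_process_events (D : set R) (X : R -> Om -> 'rV[R]_d) :
  (forall t, D t -> 0 <= t) -> is_process X ->
  process_events D X `<=` measurable.
Proof.
move=> D0 mX _ [t [i [B [Dt mB ->]]]].
by have := mX t (D0 t Dt) i measurableT _ mB; rewrite setTI.
Qed.

Definition increment (s t : R) (w : Om) : 'rV[R]_d := W t w - W s w.

Lemma measurable_increment (s t : R) i : 0 <= s -> 0 <= t ->
  measurable_fun setT (fun w => increment s t w 0 i).
Proof.
move=> s0 t0; case: hW => mW _ _ _ _.
rewrite (_ : (fun w => _) = fun w => W t w 0 i - W s w 0 i).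
  by apply: measurable_funB; exact: mW.
by apply/funext => w; rewrite !mxE.
Qed.

Lemma measurable_generated_increment (D : set R) (s t : R) i : D s -> D t ->
  @measurable_fun _ _ (g_sigma_algebraType (process_events D W)) _
    setT (fun w => increment s t w 0 i).
Proof.
move=> Ds Dt.
rewrite (_ : (fun w => _) = fun w => W t w 0 i - W s w 0 i).
  by apply: measurable_funB; exact: measurable_generated_process.
by apply/funext => w; rewrite !mxE.
Qed.

Lemma increment_mgf (s t : R) i (a : R) : 0 <= s -> s < t ->
  (\int[P]_w (expR (a * increment s t w 0 i))%:E =
   (expR (a ^+ 2 * (t - s) / 2))%:E)%E.
Proof.
move=> s0 st; have t0 : 0 <= t := le_trans s0 (ltW st).
have ts : 0 < t - s by rewrite subr_gt0.
have sq : Num.sqrt (t - s) != 0 by rewrite gt_eqF// sqrtr_gt0.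
rewrite (@normal_variable_mgf R _ sq _ Om P (fun w => increment s t w 0 i)).
- by rewrite sqr_sqrtr// ltW.
- exact: measurable_increment.
- move=> B mB; case: hW => _ _ _ + _ => /(_ s t i B s0 st mB) <-.
  by congr (P _); apply/seteqP; split => w /=; rewrite !mxE.
Qed.

Definition increment_events (s t : R) : set (set Om) :=
  [set A | exists i (U : set R), measurable U /\
     A = [set w | U (increment s t w 0 i)]].

(** The definition of Brownian motion provides the product formula for boxes of
    coordinates of the increment. For a fixed event A of the past, both sides are
    finite measures of the event of the increment, and boxes form a generating
    pi-system. *)
Lemma increment_indep (s t : R) : 0 <= s -> s < t ->
  indep_sigma P (sigma_process `[0, s] W) <<s increment_events s t>>.
Proof.
move=> s0 st A C GA HC; have t0 : 0 <= t := le_trans s0 (ltW st).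
have [mW _ _ _ hind] := hW.
pose boxes : set (set Om) := [set C | exists B : 'I_d -> set R,
  (forall i, measurable (B i)) /\
  C = [set w | forall i, B i (W t w 0 i - W s w 0 i)]].
have mboxes : boxes `<=` measurable.
  move=> _ [B [mB ->]].
  rewrite (_ : mkset _ = \bigcap_(i in [set: 'I_d])
      [set w | B i (W t w 0 i - W s w 0 i)]); last first.
    by apply/seteqP; split => [w h i _|w h i]; [exact: h|exact: (h i)].
  apply: fin_bigcap_measurable => [|i _]; first exact: finite_finset.
  have := measurable_increment i s0 t0 measurableT (mB i); rewrite setTI.
  congr measurable; apply/seteqP; split => w /=; by rewrite !mxE.
have mA : measurable A.
  move: A GA; apply: smallest_sub.
    exact: sigma_algebra_measurable.
  apply: measurable_process_events => // u.
  by rewrite /= in_itv/= => /andP[].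
have Cboxes : <<s boxes>> C.
  move: C HC; apply: smallest_sub; first exact: smallest_sigma_algebra.
  move=> _ [i [U [mU ->]]]; apply: sub_sigma_algebra.
  exists (fun k => if k == i then U else setT); split => [k|].
    by case: ifP => _ //; exact: measurableT.
  apply/seteqP; split => w /=; rewrite !mxE => h.
    by move=> k; case: eqP => [->|].
  by have := h i; rewrite eqxx.
have PA0 : 0 <= fine (P A) by rewrite fine_ge0.
have PAE : P A = (fine (P A))%:E by rewrite fineK// fin_num_measure.
pose m2 := mscale (NngNum PA0) P.
pose m1 := mrestr P mA.
suff: m1 C = m2 C.
  rewrite /m1 /mrestr setIC => ->.
  by rewrite /m2 /mscale /=; congr (_ * _)%E; rewrite -PAE.
apply: (g_sigma_algebra_measure_unique boxes mboxes (fun=> setT)) => //.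
- by exists (fun=> setT); split => //; apply/seteqP; split.
- by rewrite bigcup_const.
- move=> _ _ [B [mB ->]] [B' [mB' ->]]; exists (fun i => B i `&` B' i); split.
    by move=> i; exact: measurableI.
  apply/seteqP; split => w /=; first by move=> [h1 h2] i; split; [exact: h1|exact: h2].
  by move=> h; split => i; have [] := h i.
- move=> _ [B [mB ->]]; rewrite /m1 /m2 /mscale/= /mrestr setIC hind//.
  congr (_ * _)%E => //.
  (* with the trivial event of the past: the probability of the box itself *)
  have := hind s t setT B s0 st; rewrite setTI => H.
  apply/esym; apply: etrans (H _ mB) _.
    exact: (@measurableT _ (g_sigma_algebraType (process_events `[0, s] W))).
  by rewrite probability_setT mul1e.
- move=> _; apply: le_lt_trans (ltry 1).
  by apply: (@probability_le1 _ _ _ P); exact: measurableI.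
Qed.

End brownian_noise.

Section euler_noise.
Context (R : realType) (d : nat) (dOm : measure_display)
  (Om : measurableType dOm) (P : probability Om R) (W : R -> Om -> 'rV[R]_d).
Hypothesis hW : brownian_motion P W.
Context (h : R).
Hypothesis h0 : 0 < h.

Definition euler_noise (j : nat) (w : Om) : 'rV[R]_d :=
  increment W (j%:R * h) (j.+1%:R * h) w.

Lemma measurable_euler_noise j i :
  measurable_fun setT (fun w => euler_noise j w 0 i).
Proof. by apply: (measurable_increment hW); rewrite mulr_ge0// ltW. Qed.

Lemma euler_noise_mgf j i a :
  (\int[P]_w (expR (a * euler_noise j w 0 i))%:E =
   (expR (a ^+ 2 * h / 2))%:E)%E.
Proof.
rewrite (increment_mgf hW); last 2 first.
- by rewrite mulr_ge0// ltW.
- by rewrite ltr_pM2r// ltr_nat.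
by rewrite -mulrBl -natrB// subSnn mul1r.
Qed.

Lemma euler_noise_indep J :
  indep_sigma P <<s past euler_noise J>> <<s present euler_noise J>>.
Proof.
move=> A C GA HC; apply: (@increment_indep _ _ _ _ _ _ hW (J%:R * h) (J.+1%:R * h)).
- by rewrite mulr_ge0// ltW.
- by rewrite ltr_pM2r// ltr_nat.
- move: A GA; apply: smallest_sub; first exact: smallest_sigma_algebra.
  move=> _ [j [i [U [jJ mU ->]]]].
  have I0 k : (k <= J)%N -> (`[0, J%:R * h]%classic : set R) (k%:R * h).
    by move=> kJ; rewrite /= in_itv/= mulr_ge0 ?(ltW h0)//= ler_pM2r// ler_nat.
  have := @measurable_generated_increment _ _ _ _ W `[0, J%:R * h]%classic _ _ i
     (I0 j (ltnW jJ)) (I0 j.+1 jJ) measurableT _ mU.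
  by rewrite setTI.
- exact: HC.
Qed.

End euler_noise.

(** * Pathwise convergence of the Euler scheme *)

Lemma heine_cantor (R : realType) (V : normedModType R) (f : R -> V) (K : set R) :
  compact K -> {within K, continuous f} -> forall e : R, 0 < e ->
  exists2 del : R, 0 < del & forall u v, K u -> K v -> `|u - v| < del ->
    `|f u - f v| < e.
Proof.
move=> /compact_near_coveringP/near_covering_withinP cov cf e e0.
have := cov R (0 : R)^'+ (fun del u => forall v, K v -> `|u - v| < del ->
  `|f u - f v| < e) _.
case=> [u Ku|del del0 Hd].
  have e2 : 0 < e / 2 by rewrite divr_gt0.
  move/subspace_continuousP : cf => /(_ u Ku) /cvgrPdist_lt /(_ _ e2).
  rewrite near_withinE => /nbhs_ballP[r r0 Hr].
  have r2 : 0 < r / 2 by rewrite divr_gt0.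
  exists (ball u (r / 2), [set del | del < r / 2]).
    split; first exact: nbhsx_ballx.
    exact: nbhs_right_lt.
  move=> [u' del] [/= bu' del_lt] Ku' v Kv uv.
  have h1 : `|f u - f u'| < e / 2.
    apply: Hr => //; rewrite /ball/= in bu' *; lra.
  have h2 : `|f u - f v| < e / 2.
    apply: Hr => //; rewrite /ball/= in bu' *.
    have := ler_distD u' u v; lra.
  rewrite (le_lt_trans (ler_distD (f u) _ _))// (distrC (f u')); lra.
have del2 : 0 < del / 2 by rewrite divr_gt0.
exists (del / 2) => // u v Ku Kv uv.
apply: (Hd (del / 2)) => //=.
by rewrite sub0r normrN gtr0_norm// ltr_pdivrMr// mulr_natr mulr2n ltrDl.
Qed.

Section euclidean_topology.
Context (R : realType) (d : nat).
Implicit Types x y : 'rV[R]_d.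

Lemma coord_le_mxnorm x i : `|x 0 i| <= `|x|.
Proof.
rewrite /Num.norm/= mx_normrE.
by apply: (@le_bigmax _ _ _ 0 (fun ij : 'I_1 * 'I_d => `|x ij.1 ij.2|) (0, i)).
Qed.

Lemma l2norm_le_mxnorm x : l2norm x <= d%:R * `|x|.
Proof.
rewrite (le_trans (l2norm_le_sum _))// mulr_natl -[X in _ *+ X]card_ord -sumr_const.
by apply: ler_sum => i _; exact: coord_le_mxnorm.
Qed.

Lemma lipschitz_coord_continuous (b : 'rV[R]_d -> 'rV[R]_d) (L : R) i :
  lipschitz_wrt (@l2dist R d) (@l2dist R d) L b ->
  continuous (fun x => b x 0 i).
Proof.
move=> bL x; apply/(@cvgrPdist_lt _ _ _ (nbhs x) (nbhs_filter x)) => e e0.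
pose N := `|L| * d%:R.
have N0 : 0 <= N by rewrite mulr_ge0.
have N1 : 0 < N + 1 by lra.
apply/(@nbhs_ballP R 'rV[R]_d); exists (e / (N + 1)) => [|y xy] /=.
  exact: divr_gt0.
apply: (@le_lt_trans _ _ (N * (e / (N + 1)))).
  apply: (@le_trans _ _ (l2dist (b x) (b y))).
    by have := coord_le_l2norm (b x - b y) i; rewrite !mxE.
  apply: le_trans (bL x y) _; apply: (@le_trans _ _ (`|L| * l2dist x y)).
    by rewrite ler_wpM2r ?l2dist_ge0 ?ler_norm.
  rewrite -mulrA ler_wpM2l// (le_trans (l2norm_le_sum _))//.
  rewrite mulr_natl -[X in _ *+ X]card_ord -sumr_const ler_sum// => k _.
  by rewrite !mxE; apply/ltW; have [_] := xy; apply.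
by rewrite mulrA ltr_pdivrMr// mulrC ltr_pM2l// ltrDl.
Qed.

End euclidean_topology.

Section euler_convergence.
Context (R : realType) (d n : nat) (b : 'rV[R]_d -> 'rV[R]_d) (L : R).
Hypothesis bL : lipschitz_wrt (@l2dist R d) (@l2dist R d) L b.
Context (x W : R -> 'rV[R]_d).
Hypothesis cx : {within `[0, +oo[, continuous x}.
Hypothesis sde : forall t, 0 <= t -> forall i, x t 0 i = x 0 0 i
  - \int[lebesgue_measure]_(s in `[0, t]) (b (x s) 0 i) + W t 0 i.

Let cxT T : {within `[0, T], continuous x}.
Proof.
apply: (@continuous_subspaceW _ _ `[0, T]%classic `[0, +oo[%classic) => //.
by move=> u /=; rewrite !in_itv/= andbT => /andP[].
Qed.

Let integrable_drift i T :
  (@lebesgue_measure R).-integrable `[0, T] (EFin \o (fun s => b (x s) 0 i)).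
Proof.
apply: continuous_compact_integrable; first exact: segment_compact.
move=> u; apply: (@continuous_comp _ _ _ (x : subspace `[0, T] -> _) (fun z => b z 0 i)).
  exact: cxT.
exact: lipschitz_coord_continuous bL _.
Qed.

Lemma sde_increment (s t : R) i : 0 <= s -> s <= t ->
  x t 0 i - x s 0 i =
  W t 0 i - W s 0 i - \int[lebesgue_measure]_(u in `]s, t]) b (x u) 0 i.
Proof.
move=> s0 st; rewrite (sde (le_trans s0 st)) (sde s0).
rewrite -(@Rintegral_itvB _ _ (BLeft 0) (BRight t) s)//.
lra.
Qed.

(** The drift is evaluated at the left end of the step instead of along the path,
    and the oscillation of the path over the step is at most [omega]. *)
Lemma euler_local_error (s h omega : R) : 0 <= s -> 0 <= h ->
  (forall u, s <= u <= s + h -> l2dist (x u) (x s) <= omega) ->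
  l2norm (x (s + h) - (x s - h *: b (x s) + (W (s + h) - W s))) <=
  h * (d%:R * (`|L| * omega)).
Proof.
move=> s0 h0 om.
have sh : s <= s + h by rewrite lerDl.
rewrite (le_trans (l2norm_le_sum _))//.
rewrite mulrCA mulr_natl -[X in _ *+ X]card_ord -sumr_const; apply: ler_sum => i _.
rewrite !mxE.
have mE : lebesgue_measure (`]s, s + h]%classic : set R) = h%:E.
  rewrite lebesgue_measure_itv/= lte_fin; case: ltrP => hs.
    by rewrite -EFinB addrAC subrr add0r.
  by congr (_%:E); apply/eqP; rewrite eq_le h0/= -(lerD2l s) addr0.
have iI : (@lebesgue_measure R).-integrable `]s, s + h] (EFin \o (fun u => b (x u) 0 i)).
  apply: integrableS (integrable_drift i (s + h)) => //.
  by move=> u /=; rewrite !in_itv/= => /andP[su ->]; rewrite (le_trans s0) ?ltW.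
have iC (r : R) : (@lebesgue_measure R).-integrable `]s, s + h] (EFin \o (fun=> r)).
  apply: measurable_bounded_integrable => //.
  - by rewrite [X in (X < _)%E]mE ltry.
  - by exists `|r|; split => [|z rz u _] /=; [exact: num_real|exact: ltW].
rewrite (_ : x (s + h) 0 i - _ = (x (s + h) 0 i - x s 0 i) -
  (W (s + h) 0 i - W s 0 i) + h * b (x s) 0 i); last by ring.
rewrite sde_increment//.
rewrite (_ : _ + h * _ = - \int[lebesgue_measure]_(u in `]s, s + h])
  (b (x u) 0 i - b (x s) 0 i)); last first.
  rewrite RintegralB// Rintegral_cst//.
  rewrite [X in fine X]mE /=; lra.
have iD : (@lebesgue_measure R).-integrable `]s, s + h]
    (EFin \o (fun u => b (x u) 0 i - b (x s) 0 i)).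
  have mI : measurable (`]s, s + h]%classic : set (measurableTypeR R)) by [].
  by have := integrableB mI iI (iC (b (x s) 0 i)); apply.
rewrite normrN (le_trans (le_normr_Rintegral _ iD))//.
have -> : h * (`|L| * omega) = \int[lebesgue_measure]_(u in `]s, s + h]) (`|L| * omega).
  by rewrite Rintegral_cst// [X in fine X]mE mulrC.
apply: le_Rintegral => //.
  have := @integrable_norm _ (measurableTypeR R) R lebesgue_measure _
    (fun u => b (x u) 0 i - b (x s) 0 i) iD.
  by apply: eq_integrable.
move=> u; rewrite /= in_itv/= => /andP[su ut].
apply: (@le_trans _ _ (l2dist (b (x u)) (b (x s)))).
  by have := coord_le_l2norm (b (x u) - b (x s)) i; rewrite !mxE.
apply: le_trans (bL _ _) _; apply: (@le_trans _ _ (`|L| * l2dist (x u) (x s))).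
  by rewrite ler_wpM2r ?l2dist_ge0 ?ler_norm.
by rewrite ler_wpM2l// om// ltW.
Qed.

(** Local errors add up without amplification, because a step of the scheme does
    not increase distances. *)
Lemma euler_global_error (h rho omega T : R) (m : 'I_n -> nat) :
  0 <= h -> 0 <= rho -> rho <= 1 ->
  (forall y z v, l2dist (y - h *: b y + v) (z - h *: b z + v) <=
     rho * l2dist y z) ->
  (forall u v, 0 <= u <= T -> 0 <= v <= T -> `|u - v| <= h ->
     l2dist (x u) (x v) <= omega) ->
  forall J i, J%:R * h <= T ->
  l2dist (euler_chain b h m (fun j => W (j.+1%:R * h) - W (j%:R * h))
            (fun=> x 0) J i) (x ((minn J (m i))%:R * h)) <=
  (minn J (m i))%:R * (h * (d%:R * (`|L| * omega))).
Proof.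
move=> h0 rho0 rho1 contraction om; elim=> [|J IH] i JT.
  by rewrite min0n /= !mul0r l2dist_refl.
have hJ : J.+1%:R * h = J%:R * h + h by rewrite -natr1 mulrDl mul1r.
have Jh0 : 0 <= J%:R * h by rewrite mulr_ge0.
have JT' : J%:R * h <= T by apply: le_trans JT; rewrite hJ lerDl.
have {}IH := IH i JT'.
rewrite /= /euler_step; case: ltnP => Jm; last first.
  rewrite (minn_idPr Jm) in IH.
  by rewrite (minn_idPr (leq_trans Jm (leqnSn J))).
rewrite (minn_idPl (ltnW Jm)) in IH.
rewrite (minn_idPl Jm).
move: IH; set Y := euler_chain _ _ _ _ _ _ _; set X := x (J%:R * h) => IH.
set c := h * (d%:R * (`|L| * omega)) in IH *.
have loc : l2norm (x (J.+1%:R * h) - (X - h *: b X +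
    (W (J.+1%:R * h) - W (J%:R * h)))) <= c.
  rewrite hJ; apply: euler_local_error => // u /andP[u1 u2].
  apply: om.
  - by rewrite (le_trans Jh0 u1)/= (le_trans u2)// -hJ.
  - by rewrite Jh0.
  - by rewrite ger0_norm ?subr_ge0// lerBlDl.
rewrite (_ : l2dist _ _ = l2norm (((Y - h *: b Y + (W (J.+1%:R * h) - W (J%:R * h)))
   - (X - h *: b X + (W (J.+1%:R * h) - W (J%:R * h)))) +
   ((X - h *: b X + (W (J.+1%:R * h) - W (J%:R * h))) - x (J.+1%:R * h)))); last first.
  by rewrite /l2dist; congr l2norm; rewrite [RHS]addrA subrK.
apply: le_trans (l2normD _ _) _.
rewrite -[X in _ <= X * _]natr1 [leRHS]mulrDl mul1r; apply: lerD.
  apply: le_trans (contraction _ _ _) _; apply: le_trans IH.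
  by rewrite ler_piMl// l2dist_ge0.
apply: le_trans loc; rewrite -[leLHS]/(l2dist _ _) l2distC; exact: lexx.
Qed.

(** Noise being additive, convergence holds for each continuous path of the
    diffusion separately: the modulus of continuity of the path bounds the error. *)
Lemma euler_chain_cvg (Delta : R) (q : 'I_n -> nat) (Q N1 : nat) (rho : nat -> R) :
  0 < Delta -> (forall i, (q i <= Q)%N) ->
  (forall N, (N1 <= N)%N -> [/\ 0 <= rho N, rho N <= 1 &
    forall y z v, l2dist (y - (Delta / N.+1%:R) *: b y + v)
                         (z - (Delta / N.+1%:R) *: b z + v) <=
     rho N * l2dist y z]) ->
  forall e : R, 0 < e -> exists N0, forall N, (N0 <= N)%N -> forall i,
  let h := Delta / N.+1%:R in
  l2dist (euler_chain b h (fun i => N.+1 * q i)%N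
            (fun j => W (j.+1%:R * h) - W (j%:R * h))
            (fun=> x 0) (N.+1 * Q) i) (x ((q i)%:R * Delta)) <= e.
Proof.
move=> D0 qQ hrho e e0.
set T := Q%:R * Delta.
(* the global error is at most A times the modulus of continuity *)
pose A := T * (d%:R * (`|L| * d%:R)).
have T0 : 0 <= T by rewrite mulr_ge0 ?ler0n// ltW.
have A0 : 0 <= A by rewrite !mulr_ge0 ?ler0n ?(ltW D0).
have A1 : 0 < A + 1 by lra.
have e1 : 0 < e / (A + 1) by rewrite divr_gt0.
have [del del0 Hdel] := heine_cantor (@segment_compact R 0 T) (cxT (T := T)) e1.
have [k _ Hk] := near_infty_natSinv_lt (PosNum (divr_gt0 del0 D0)).
exists (maxn N1 k) => N NN i; cbv zeta; set h := Delta / N.+1%:R.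
have N1N : (N1 <= N)%N := leq_trans (leq_maxl _ _) NN.
have kN : (k <= N)%N := leq_trans (leq_maxr _ _) NN.
have h0 : 0 < h by rewrite divr_gt0 ?ltr0Sn.
have hdel : h < del.
  have := Hk N kN; rewrite /= => H.
  by rewrite /h mulrC -ltr_pdivlMr.
have [r0 r1 contr] := hrho N N1N.
have Nh : N.+1%:R * h = Delta by rewrite /h mulrC divfK// pnatr_eq0.
have := @euler_global_error h (rho N) (d%:R * (e / (A + 1))) T (fun i => N.+1 * q i)%N
  (ltW h0) r0 r1 contr _ (N.+1 * Q)%N i.
rewrite (minn_idPr _) ?leq_mul2l ?qQ ?orbT//.
rewrite !natrM ![_ * _ * h]mulrAC !Nh ![Delta * _]mulrC => H.
apply: le_trans (H _ _) _ => //.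
  move=> u v uT vT uv; apply: le_trans (l2norm_le_mxnorm _) _.
  rewrite ler_wpM2l//; apply/ltW; apply: Hdel => //=; rewrite ?in_itv//.
  exact: le_lt_trans uv hdel.
apply: (@le_trans _ _ (A * (e / (A + 1)))).
  rewrite (_ : _ * _ * (h * _) = (q i)%:R * (N.+1%:R * h) *
    (d%:R * (`|L| * (d%:R * (e / (A + 1)))))); last by ring.
  rewrite Nh; move: (e / (A + 1)) e1 => e' e1.
  rewrite /A /T -!mulrA; apply: ler_wpM2r; last by rewrite ler_nat.
  by rewrite !mulr_ge0 ?(ltW D0) ?(ltW e1) ?ler0n.
by rewrite mulrA ler_pdivrMr// mulrC ler_pM2l// lerDl.
Qed.

End euler_convergence.

(** * Limits and stationarity *)

Section limits.
Context (R : realType) (dOm : measure_display) (Om : measurableType dOm)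
  (P : probability Om R).

Lemma dominated_expectation (f_ : nat -> Om -> R) (f g : Om -> R) :
  (forall N, measurable_fun setT (f_ N)) -> measurable_fun setT f ->
  {ae P, forall w, f_ N w @[N --> \oo] --> f w} ->
  L1 P g -> (forall N w, `|f_ N w| <= g w) ->
  \int[P]_w f_ N w @[N --> \oo] --> \int[P]_w f w.
Proof.
move=> mf_ mf cvf lg fg.
have [] := @dominated_convergence _ _ _ P setT measurableT
  (fun N => EFin \o f_ N) (EFin \o f) (EFin \o g) _ _ _ lg _.
- by move=> N; exact/measurable_EFinP.
- exact/measurable_EFinP.
- apply: filterS cvf => w cw _; apply/fine_cvgP; split; last exact: cw.
  exact: nearW.
- by apply: aeW => w N _; rewrite lee_fin.
move=> if_ _ cvI.
apply: fine_cvg; rewrite EFin_Rintegral//; exact: cvI.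
Qed.

(** Stationarity is an equality of probabilities on the product sigma-algebra of the
    path space, that is, of two image measures of [P]. *)
Lemma integral_stationary (d : nat) (X : R -> Om -> 'rV[R]_d) :
  is_process X -> stationary_process P X ->
  forall (s : R) (g : (R -> 'rV[R]_d) -> \bar R), 0 <= s ->
  measurable_fun
    [set: g_sigma_algebraType
       (process_events `[0, +oo[ (fun t (x : R -> 'rV[R]_d) => x t))] g ->
  (forall x, 0 <= g x)%E ->
  (\int[P]_w g (fun t => X (s + t)%R w) = \int[P]_w g (X ^~ w))%E.
Proof.
move=> mX stX s g s0 mg g0.
pose gen : set (set (R -> 'rV[R]_d)) :=
  process_events `[0, +oo[ (fun t (x : R -> 'rV[R]_d) => x t).
have mpath (r : R) : 0 <= r ->
    @measurable_fun _ _ Om (g_sigma_algebraType gen) setT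
      (fun w t => X (r + t) w).
  move=> r0; apply: (@measurability _ _ Om (g_sigma_algebraType gen) setT
    (fun w t => X (r + t) w) gen) => //.
  move=> _ [_ [t [i [B [t0 mB ->]]]] <-].
  apply: (mX (r + t) _ i measurableT B mB).
  by rewrite addr_ge0//; move: t0; rewrite /= in_itv/= andbT.
pose f (r : R) (r0 : 0 <= r) : {mfun Om >-> g_sigma_algebraType gen} :=
  @mfun_Sub _ _ Om (g_sigma_algebraType gen) _ (mem_set (mpath r r0)).
have E1 (r : R) (r0 : 0 <= r) : (\int[P]_w g (fun t => X (r + t)%R w) =
    \int[distribution P (f r r0)]_x g x)%E.
  by rewrite ge0_integral_distribution.
have -> : (\int[P]_w g (X ^~ w) = \int[P]_w g (fun t => X (0 + t)%R w))%E.
  by apply: eq_integral => w _; congr g; apply/funext => t; rewrite add0r.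
rewrite (E1 s s0) (E1 0 (lexx 0)).
apply: eq_measure_integral => A mA _.
exact: etrans (stX s A s0 mA) (esym (stX 0 A (lexx 0) mA)).
Qed.

End limits.

(** [q] sampling periods of N + 1 steps each: the contraction accumulated by the
    scheme is exponential in time, uniformly in the mesh. *)
Lemma contraction_le_expR (R : realType) (M Delta : R) (N k q : nat) :
  M * (Delta / N.+1%:R) <= 2 -> (k <= q)%N ->
  0 <= M * Delta ->
  (1 - M * (Delta / N.+1%:R) / 2) ^+ (N.+1 * q) <= expR (- (M * Delta / 2 * k%:R)).
Proof.
move=> MD kq MD0; set h := Delta / N.+1%:R in MD *.
have h0 : 0 <= M * h by rewrite /h mulrA divr_ge0.
have r0 : 0 <= 1 - M * h / 2 by lra.
have r1 : 1 - M * h / 2 <= 1 by lra.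
apply: (@le_trans _ _ ((1 - M * h / 2) ^+ (N.+1 * k))).
  by rewrite ler_wiXn2l// leq_mul2l kq orbT.
apply: (@le_trans _ _ (expR (- (M * h / 2)) ^+ (N.+1 * k))).
  by rewrite lerXn2r ?nnegrE ?expR_ge0// (le_trans _ (expR_ge1Dx _)).
rewrite -expRM_natl ler_expR natrM.
have -> : (N.+1%:R * k%:R) * - (M * h / 2) = - (M * (N.+1%:R * h) / 2 * k%:R) by ring.
by rewrite /h [N.+1%:R * _]mulrC divfK ?pnatr_eq0.
Qed.

(** * Random initial condition *)

Section random_start.
Context (R : realType) (d n : nat) (b : 'rV[R]_d -> 'rV[R]_d) (L M : R).
Local Notation state := ('I_n -> 'rV[R]_d).
Hypothesis M0 : 0 < M.
Hypothesis bL : lipschitz_wrt (@l2dist R d) (@l2dist R d) L b.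
Hypothesis bM : forall x y, M * l2norm (x - y) ^+ 2 <= dotp (b x - b y) (x - y).
Context (dOm : measure_display) (Om : measurableType dOm)
  (P : probability Om R) (W X : R -> Om -> 'rV[R]_d).
Hypothesis hW : brownian_motion P W.
Hypothesis mX : is_process X.
Hypothesis hX0 : indep_sigma P (sigma_process [set 0] X)
             (sigma_process `[0, +oo[ W).
Context (Nm : ('I_n -> R) -> R) (B Delta : R).
Hypothesis gNm : gauge Nm.
Hypothesis Delta0 : 0 < Delta.

Definition gauge_observable (F : state -> R) :=
  (forall s, `|F s| <= B) /\
  (forall s s', `|F s - F s'| <= Nm (fun i => l2dist (s i) (s' i))).

Lemma gauge_observableN F : gauge_observable F ->
  gauge_observable (fun s => - F s).
Proof.
by case=> FB FN; split=> [s|s s']; rewrite ?normrN//= -opprD normrN.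
Qed.

(** The mesh has N + 1 steps per sampling period, and the samples are taken after a
    burn-in of [k] periods. *)
Context (N k : nat).
Local Notation h := (Delta / N.+1%:R).
Local Notation rho := (1 - M * h / 2).
Local Notation m := (fun i : 'I_n => (N.+1 * (k + i.+1))%N).
Local Notation J := (N.+1 * (k + n))%N.
Hypothesis hL : L ^+ 2 * h <= M.
Hypothesis hM : M * h <= 2.

Let h0 : 0 < h. Proof. by rewrite divr_gt0. Qed.
Let Mh0 : 0 < M * h. Proof. exact: mulr_gt0. Qed.
Let rho0 : 0 <= rho. Proof. by rewrite subr_ge0 ler_pdivrMr// mul1r. Qed.
Let rho1 : rho <= 1. Proof. by rewrite gerBl divr_ge0 ?ltW. Qed.
Let contraction : forall x y v,
  l2dist (x - h *: b x + v) (y - h *: b y + v) <= rho * l2dist x y.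
Proof. exact: drift_step_contraction bL bM (ltW h0) hL hM. Qed.

Definition discrete_sde (x : 'rV[R]_d) (w : Om) : state :=
  euler_chain b h m (euler_noise W h ^~ w) (fun=> x) J.

Let gapJ (s s' : state) : gap rho m Nm J s s' = Nm (fun i => l2dist (s i) (s' i)).
Proof.
congr Nm; apply/funext => i.
rewrite (_ : _ - _ = 0)%N ?expr0 ?mul1r//.
by apply/eqP; rewrite subn_eq0 leq_mul2l leq_add2l ltn_ord orbT.
Qed.

Let loglip F : gauge_observable F -> log_lipschitz rho m Nm B J (fun s => expR (F s)).
Proof.
case=> FB FN; split => [s|s s'].
  by rewrite !ler_expR; move: (FB s); rewrite ler_norml.
rewrite -expRD ler_expR gapJ -lerBlDl.
exact: le_trans (ler_norm _) (FN s s').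
Qed.

Let mchain x i c : measurable_fun setT (fun w => discrete_sde x w i 0 c).
Proof.
apply: (@measurable_euler_chain _ _ _ b h L m bL _ _
  (euler_noise W h) (fun=> fun=> x)) => //.
by move=> j c' _; exact: (measurable_euler_noise hW h0).
Qed.

Let L1chain F x : gauge_observable F -> L1 P (fun w => expR (F (discrete_sde x w))).
Proof.
move=> oF; have := @log_lipschitz_L1 R d n rho m Nm gNm rho0 rho1 dOm Om P B J _
  (discrete_sde x) (loglip oF) (mchain x).
by [].
Qed.

Definition start_expectation (F : state -> R) (x : 'rV[R]_d) : R :=
  \int[P]_w expR (F (discrete_sde x w)).

Let eps : R := expR (- (M * Delta / 2 * k%:R)) * Nm (fun=> 1).

Let eps0 : 0 <= eps.
Proof.
rewrite mulr_ge0 ?expR_ge0//.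
by apply: (gauge_ge0 gNm (u := fun=> 1)) => i; exact: ler01.
Qed.

Lemma start_expectation_gt0 F x : gauge_observable F -> 0 < start_expectation F x.
Proof.
move=> oF; apply: (@lt_le_trans _ _ (expR (- B))); first exact: expR_gt0.
rewrite -(Rintegral_probability_cst P (expR (- B))).
apply: le_expectation => [||w]; [exact: L1_cst|exact: L1chain|].
by rewrite ler_expR; move: (oF.1 (discrete_sde x w)); rewrite ler_norml => /andP[].
Qed.

(** The chains started at [x] and [y] with the same noise are eps * |x - y| apart
    when the samples are taken, up to the gauge; the cut-off 2 B, from the bound
    on [F], makes the right-hand side integrable in [x] whatever the initial law. *)
Lemma start_expectation_lip F x y : gauge_observable F ->
  start_expectation F x <=
  start_expectation F y * expR (Num.min (2 * B) (eps * l2dist x y)).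
Proof.
move=> oF; rewrite mulrC -RintegralZl//; last exact: L1chain.
apply: le_expectation; [exact: L1chain|by apply: L1Z; exact: L1chain|move=> w].
rewrite -expRD ler_expR -lerBlDr le_min.
set s := discrete_sde x w; set s' := discrete_sde y w.
have [FB FN] := oF; apply/andP; split.
  move: (FB s) (FB s'); rewrite !ler_norml; lra.
apply: le_trans (ler_norm _) _; apply: le_trans (FN _ _) _.
rewrite -gapJ; apply: le_trans (gap_chain m gNm rho0 contraction _ _ _ _) _ => //.
rewrite /gap /eps [leRHS]mulrAC; apply: (gauge_le_cst gNm) => [|i].
  by rewrite mulr_ge0 ?expR_ge0 ?l2dist_ge0.
rewrite subn0 mulr_ge0 ?exprn_ge0 ?l2dist_ge0//=.
rewrite ler_wpM2r ?l2dist_ge0//.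
by apply: contraction_le_expR => //; [rewrite leq_addr|rewrite mulr_ge0 ?ltW].
Qed.

Lemma measurable_start_expectation F :
  gauge_observable F ->
  measurable_fun setT (fun w => start_expectation F (X 0 w)).
Proof.
move=> oF; have pos x := start_expectation_gt0 x oF.
rewrite (_ : (fun w => _) = fun w => expR (ln (start_expectation F (X 0 w)))); last first.
  by apply/funext => w; rewrite lnK// posrE.
apply: measurableT_comp => //.
apply: (@measurable_lipschitz_vector _ _ _ _
  (fun x => ln (start_expectation F x)) _ _ eps0) => [x y|i]; last exact: mX.
have H u v : ln (start_expectation F u) - ln (start_expectation F v) <= eps * l2dist u v.
  rewrite lerBlDl -(ler_expR (ln (start_expectation F u))) expRD !lnK ?posrE//.
  apply: le_trans (start_expectation_lip u v oF) _.
  by rewrite ler_wpM2l ?(ltW (pos _))// ler_expR ge_min lexx orbT.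
by rewrite ler_norml H andbT lerNl opprB l2distC.
Qed.

Local Notation start_events := (process_events [set 0] X).
Local Notation noise_events := (process_events `[0, +oo[ W).
Local Notation start_noise :=
  (g_sigma_algebraType start_events * g_sigma_algebraType noise_events)%type.

Lemma random_start_expectation F : gauge_observable F ->
  \int[P]_w expR (F (discrete_sde (X 0 w) w)) =
  \int[P]_w start_expectation F (X 0 w).
Proof.
move=> oF; congr fine.
have mW : is_process W by case: hW.
pose chain (z : start_noise) : state :=
  euler_chain b h m (fun j => euler_noise W h j z.2) (fun=> X 0 z.1) J.
pose g z : \bar R := (expR (F (chain z)))%:E.
have gE := @integral_indep R dOm Om P start_events noise_events _ _ hX0 g.
rewrite /= in gE; rewrite gE.
- by apply: eq_integral => w _; rewrite EFin_Rintegral//; exact: L1chain.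
- by apply: measurable_process_events => // t /= ->.
- by apply: measurable_process_events => // t; rewrite /= in_itv/= andbT.
- apply/measurable_EFinP; apply: measurableT_comp => //.
  apply: (measurable_gauge_lipschitz gNm oF.2 (Z := chain)) => i c.
  apply: (@measurable_euler_chain _ _ _ b h L m bL _ _
    (fun j (z : start_noise) => euler_noise W h j z.2)
    (fun z : start_noise => fun=> X 0 z.1)).
    move=> i' c'; apply: (measurableT_comp
      (f := fun w : g_sigma_algebraType start_events => X 0 w 0 c')) => //.
    exact: measurable_generated_process.
  move=> j c' _; apply: (measurableT_comp
    (f := fun w : g_sigma_algebraType noise_events =>
       euler_noise W h j w 0 c')) => //.
  by apply: measurable_generated_increment; rewrite /= in_itv/= andbT mulr_ge0// ltW.
- by move=> z; rewrite lee_fin expR_ge0.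
Qed.

(** By the previous estimate both factors are compared with the chain started at
    the origin, to which the concentration of the Euler chain applies; the last
    factor is the price of this comparison. *)
Lemma random_start_product F Gam : gauge_observable F ->
  \sum_(j < J) (h * influence rho m Nm j ^+ 2) <= Gam ->
  (\int[P]_w expR (F (discrete_sde (X 0 w) w))) *
  (\int[P]_w expR (- F (discrete_sde (X 0 w) w))) <=
  expR (d%:R ^+ 2 * Gam) *
  (\int[P]_w expR (Num.min (2 * B) (eps * l2norm (X 0 w)))) ^+ 2.
Proof.
move=> oF hGam; have oNF := gauge_observableN oF.
have prod0 : start_expectation F 0 * start_expectation (fun s => - F s) 0 <=
    expR (d%:R ^+ 2 * Gam).
  have := @chain_concentration R d n b h rho L m Nm gNm rho0 rho1 contraction bL
    dOm Om P (euler_noise W h) B (measurable_euler_noise hW h0)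
    (euler_noise_indep hW h0) (euler_noise_mgf hW h0) J _ (fun=> 0) (loglip oF).
  move=> H; rewrite /start_expectation.
  under [X in _ * X <= _]eq_Rintegral do rewrite expRN.
  apply: le_trans H _; rewrite ler_expR ler_wpM2l ?exprn_ge0//.
set a := \int[P]_w expR (Num.min _ _).
have La : L1 P (fun w => expR (Num.min (2 * B) (eps * l2norm (X 0 w)))).
  apply: (@L1_bounded _ _ _ _ _ (expR (2 * B))) => [|w].
    apply: measurableT_comp => //; apply: measurable_minr => //.
    apply: measurable_funM => //.
    apply: (@measurable_lipschitz_vector _ _ _ _ (@l2norm R d) 1) => // [x y|i].
      by rewrite mul1r l2norm_lipschitz.
    exact: mX.
  by rewrite ger0_norm ?expR_ge0// ler_expR ge_min lexx.
have bound F' : gauge_observable F' ->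
    \int[P]_w expR (F' (discrete_sde (X 0 w) w)) <= start_expectation F' 0 * a.
  move=> oF'; rewrite random_start_expectation// -RintegralZl//.
  have lip w : start_expectation F' (X 0 w) <= start_expectation F' 0 *
      expR (Num.min (2 * B) (eps * l2norm (X 0 w))).
    by have := start_expectation_lip (X 0 w) 0 oF'; rewrite /l2dist subr0.
  apply: le_expectation => //; last exact: L1Z.
  apply: (@L1_bounded _ _ _ _ _ (start_expectation F' 0 * expR (2 * B))).
    exact: measurable_start_expectation.
  move=> w; rewrite gtr0_norm ?start_expectation_gt0// (le_trans (lip w))//.
  by rewrite ler_wpM2l ?ler_expR ?ge_min ?lexx// ltW// start_expectation_gt0.
have a0 : 0 <= a by apply: Rintegral_ge0 => w _; exact: expR_ge0.
apply: (@le_trans _ _ ((start_expectation F 0 * a) *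
   (start_expectation (fun s => - F s) 0 * a))).
  apply: ler_pM; [by apply: Rintegral_ge0 => w _; exact: expR_ge0|
    by apply: Rintegral_ge0 => w _; exact: expR_ge0|exact: bound|exact: (bound _ oNF)].
rewrite mulrACA -expr2; apply: ler_wpM2r => //.
exact: exprn_ge0.
Qed.

End random_start.

(** * Bounded functionals of the diffusion *)

Lemma small_enough_steps (R : realType) (L M Delta : R) : 0 < M -> 0 < Delta ->
  exists N1, forall N, (N1 <= N)%N ->
    L ^+ 2 * (Delta / N.+1%:R) <= M /\ M * (Delta / N.+1%:R) <= 2.
Proof.
move=> M0 D0.
pose c : R := M / (Delta * (L ^+ 2 + 1)).
pose c' : R := 2 / (M * Delta).
have L0 : 0 < L ^+ 2 + 1 by rewrite ltr_wpDl// sqr_ge0.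
have c0 : 0 < c by rewrite divr_gt0// mulr_gt0.
have c0' : 0 < c' by rewrite divr_gt0// mulr_gt0.
have [k _ Hk] := near_infty_natSinv_lt (PosNum c0).
have [k' _ Hk'] := near_infty_natSinv_lt (PosNum c0').
exists (maxn k k') => N NN.
have /= H := Hk N (leq_trans (leq_maxl _ _) NN).
have /= H' := Hk' N (leq_trans (leq_maxr _ _) NN).
split.
- apply: (@le_trans _ _ ((L ^+ 2 + 1) * (Delta * c))).
    apply: ler_pM; rewrite ?sqr_ge0 ?lerDl ?divr_ge0 ?(ltW D0)//.
    by rewrite ler_pM2l// ltW.
  rewrite /c le_eqVlt; apply/orP; left; apply/eqP; field.
  by rewrite !gt_eqF.
- apply: (@le_trans _ _ (M * (Delta * c'))).
    by rewrite !ler_pM2l// ltW.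
  rewrite /c' le_eqVlt; apply/orP; left; apply/eqP; field.
  by rewrite !gt_eqF.
Qed.

Section bounded_observable.
Context (R : realType) (d n : nat) (b : 'rV[R]_d -> 'rV[R]_d) (L M : R).
Local Notation state := ('I_n -> 'rV[R]_d).
Hypothesis M0 : 0 < M.
Hypothesis bL : lipschitz_wrt (@l2dist R d) (@l2dist R d) L b.
Hypothesis bM : forall x y, M * l2norm (x - y) ^+ 2 <= dotp (b x - b y) (x - y).
Context (dOm : measure_display) (Om : measurableType dOm)
  (P : probability Om R) (W X : R -> Om -> 'rV[R]_d).
Hypothesis hW : brownian_motion P W.
Hypothesis hX : sde_solution P b W X.
Hypothesis hX0 : indep_sigma P (sigma_process [set 0] X)
             (sigma_process `[0, +oo[ W).
Hypothesis hXs : stationary_process P X.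
Context (Nm : ('I_n -> R) -> R) (Delta : R).
Hypothesis gNm : gauge Nm.
Hypothesis Delta0 : 0 < Delta.

Let mX : is_process X. Proof. by case: hX. Qed.

(** The exponent of the Euler chain, bounded uniformly in the mesh and in the length
    of the burn-in; the contraction factor is that of [drift_step_contraction]. *)
Definition total_influence_le (Gam : R) := exists N1, forall N k, (N1 <= N)%N ->
  \sum_(j < N.+1 * (k + n)) (Delta / N.+1%:R *
     influence (1 - M * (Delta / N.+1%:R) / 2)
       (fun i : 'I_n => N.+1 * (k + i.+1))%N Nm j ^+ 2) <= Gam.

Definition sampled (k : nat) (w : Om) : state :=
  fun i => X ((k + i.+1)%:R * Delta) w.

Let sample_ge0 k (i : 'I_n) : 0 <= (k + i.+1)%:R * Delta.
Proof. by rewrite mulr_ge0// ltW. Qed.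

Section bound.
Context (B : R) (F : state -> R).
Hypothesis oF : gauge_observable Nm B F.

Let B0 : 0 <= B. Proof. exact: le_trans (normr_ge0 _) (oF.1 (fun=> 0)). Qed.

Lemma measurable_sampled k : measurable_fun setT (fun w => F (sampled k w)).
Proof.
apply: (measurable_gauge_lipschitz gNm oF.2 (Z := sampled k)) => i j.
exact: mX.
Qed.

Lemma discrete_sde_cvg k : {ae P, forall w,
  F (discrete_sde b W Delta N k (X 0 w) w) @[N --> \oo] --> F (sampled k w)}.
Proof.
have [_ cX eX] := hX.
apply: filterS2 cX eX => w cw ew; apply/cvgrPdist_le => e e0.
have [N1 HN1] := small_enough_steps L M0 Delta0.
have c0 : 0 <= Nm (fun=> 1).
  by apply: (gauge_ge0 gNm (u := fun=> 1)) => i; exact: ler01.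
have c1 : 0 < Nm (fun=> 1) + 1 by rewrite ltr_wpDl.
have [|||N0 HN0] := @euler_chain_cvg R d n b L bL (X ^~ w) (W ^~ w) cw ew Delta
  (fun i : 'I_n => (k + i.+1)%N) (k + n)%N N1 (fun N => 1 - M * (Delta / N.+1%:R) / 2)
  Delta0 _ _ (e / (Nm (fun=> 1) + 1)).
- by move=> i; rewrite leq_add2l.
- move=> N /HN1[h1 h2]; have h0 : 0 < Delta / N.+1%:R by rewrite divr_gt0.
  split; first by rewrite subr_ge0 ler_pdivrMr// mul1r.
    by rewrite gerBl divr_ge0// mulr_ge0 ?ltW.
  exact: drift_step_contraction bL bM (ltW h0) h1 h2.
- by rewrite divr_gt0.
exists N0 => // N /= /HN0 H.
apply: le_trans (oF.2 _ _) _.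
apply: (@le_trans _ _ (e / (Nm (fun=> 1) + 1) * Nm (fun=> 1))).
  apply: (gauge_le_cst gNm) => [|i]; first by rewrite divr_ge0 ?(ltW e0) ?(ltW c1).
  by rewrite l2dist_ge0/= l2distC; exact: H.
by rewrite mulrAC ler_pdivrMr// ler_pM2l// lerDl.
Qed.

Lemma measurable_discrete_sde N k :
  measurable_fun setT (fun w => F (discrete_sde b W Delta N k (X 0 w) w)).
Proof.
apply: (measurable_gauge_lipschitz gNm oF.2
  (Z := fun w => discrete_sde b W Delta N k (X 0 w) w)) => i c.
apply: (@measurable_euler_chain _ _ _ b _ L _ bL _ _
  (euler_noise W (Delta / N.+1%:R)) (fun w => fun=> X 0 w)).
  by move=> _ c'; exact: mX.
by move=> j c' _; apply: (measurable_euler_noise hW); rewrite divr_gt0.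
Qed.

Lemma expectation_discrete_sde_cvg k :
  \int[P]_w expR (F (discrete_sde b W Delta N k (X 0 w) w)) @[N --> \oo]
  --> \int[P]_w expR (F (sampled k w)).
Proof.
apply: (dominated_expectation (g := fun=> expR B)).
- by move=> N; apply: measurableT_comp => //; exact: measurable_discrete_sde.
- by apply: measurableT_comp => //; exact: measurable_sampled.
- apply: filterS (discrete_sde_cvg k) => w cw.
  by apply: (cvg_comp _ expR cw); exact: continuous_expR.
- exact: L1_cst.
- move=> N w; rewrite ger0_norm ?expR_ge0// ler_expR.
  exact: le_trans (ler_norm _) (oF.1 _).
Qed.

Lemma expectation_sampled k :
  \int[P]_w expR (F (sampled k w)) = \int[P]_w expR (F (sampled 0 w)).
Proof.
congr fine.
pose g (x : R -> 'rV[R]_d) : \bar R :=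
  (expR (F (fun i : 'I_n => x ((0 + i.+1)%:R * Delta))))%:E.
have := @integral_stationary R _ Om P d X mX hXs (k%:R * Delta) g.
have -> : (fun w => g (fun t => X (k%:R * Delta + t) w)) =
    (fun w => (expR (F (sampled k w)))%:E).
  apply/funext => w; congr (expR (F _))%:E; apply/funext => i.
  by rewrite /sampled add0n natrD mulrDl.
apply.
- by rewrite mulr_ge0// ltW.
- apply/measurable_EFinP; apply: measurableT_comp => //.
  apply: (measurable_gauge_lipschitz gNm oF.2 (Z := fun (x : g_sigma_algebraType
    (process_events `[0, +oo[ (fun t (x : R -> 'rV[R]_d) => x t))) (i : 'I_n) =>
    x ((0 + i.+1)%:R * Delta))) => i j.
  by apply: measurable_generated_process; rewrite /= in_itv/= andbT sample_ge0.
- by move=> x; rewrite lee_fin expR_ge0.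
Qed.

End bound.

(** By stationarity the samples may be taken after a burn-in of [k] periods. For a
    fixed [k] the mesh tends to zero; then [k] tends to infinity, and the
    dependence on the initial law disappears. *)
Lemma bounded_concentration (B Gam : R) (F : state -> R) :
  gauge_observable Nm B F -> total_influence_le Gam ->
  (\int[P]_w expR (F (sampled 0 w))) * (\int[P]_w expR (- F (sampled 0 w))) <=
  expR (d%:R ^+ 2 * Gam).
Proof.
move=> oF [N2 hGam]; have oNF := gauge_observableN oF.
have B0 : 0 <= B := le_trans (normr_ge0 _) (oF.1 (fun=> 0)).
pose eps k := expR (- (M * Delta / 2 * k%:R)) * Nm (fun=> 1).
have c0 : 0 <= Nm (fun=> 1).
  by apply: (gauge_ge0 gNm (u := fun=> 1)) => i; exact: ler01.
pose a k := \int[P]_w expR (Num.min (2 * B) (eps k * l2norm (X 0 w))).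
have step k : (\int[P]_w expR (F (sampled 0 w))) * (\int[P]_w expR (- F (sampled 0 w)))
    <= expR (d%:R ^+ 2 * Gam) * a k ^+ 2.
  rewrite -(expectation_sampled oF k) -(expectation_sampled oNF k).
  apply: (cvgr_to_le (cvgM (expectation_discrete_sde_cvg oF (k := k))
    (expectation_discrete_sde_cvg oNF (k := k)))).
  have [N1 HN1] := small_enough_steps L M0 Delta0.
  exists (maxn N1 N2) => // N /= NN.
  have [h1 h2] := HN1 N (leq_trans (leq_maxl _ _) NN).
  apply: (random_start_product M0 bL bM hW mX hX0 gNm Delta0 h1 h2 oF).
  exact: hGam (leq_trans (leq_maxr _ _) NN).
have eps_cvg : eps k @[k --> \oo] --> (0 : R).
  rewrite -(mul0r (Nm (fun=> 1))); apply: cvgM; last exact: cvg_cst.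
  have -> : (fun k => expR (- (M * Delta / 2 * k%:R))) =
      geometric 1 (expR (- (M * Delta / 2))) :> (nat -> R).
    by apply/funext => k; rewrite /= mul1r -expRM_natl; congr expR; ring.
  apply: cvg_geometric; rewrite ger0_norm ?expR_ge0// -expR0 ltr_expR.
  by rewrite oppr_lt0 divr_gt0// mulr_gt0.
have a_cvg : a k @[k --> \oo] --> (1 : R).
  rewrite -[X in _ --> X](Rintegral_probability_cst P 1).
  apply: (dominated_expectation (g := fun=> expR (2 * B))).
  - move=> k; apply: measurableT_comp => //; apply: measurable_minr => //.
    apply: measurable_funM => //.
    apply: (@measurable_lipschitz_vector _ _ _ _ (@l2norm R d) 1) => // [x y|i].
      by rewrite mul1r l2norm_lipschitz.
    exact: mX.
  - exact: measurable_cst.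
  - apply: aeW => w; move: (l2norm _) (l2norm_ge0 (X 0 w)) => r r0.
    apply: (@squeeze_cvgr _ _ _ _ (fun=> 1) (fun k => expR (eps k * r))).
    + apply: nearW => k; rewrite ler_expR ge_min lexx orbT andbT.
      by rewrite -[leLHS]expR0 ler_expR le_min !mulr_ge0 ?expR_ge0.
    + exact: cvg_cst.
    + have er : eps k * r @[k --> \oo] --> 0 * r.
        by apply: cvgM => //; exact: cvg_cst.
      rewrite -expR0 -(mul0r r).
      by apply: (cvg_comp _ expR er); exact: continuous_expR.
  - exact: L1_cst.
  - by move=> k w; rewrite ger0_norm ?expR_ge0// ler_expR ge_min lexx.
set C := expR _ in step *.
have Ca_cvg : C * (a k * a k) @[k --> \oo] --> C * (1 * 1).
  by apply: cvgM; [exact: cvg_cst|exact: cvgM].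
rewrite -[C]mulr1 -[X in C * X](mulr1 1).
apply: (cvgr_to_ge Ca_cvg); apply: nearW => k.
by rewrite -expr2; exact: step.
Qed.

End bounded_observable.

(** * Removing boundedness, and centring *)

Definition clip (R : realType) (B x : R) : R := Num.max (- B) (Num.min B x).

Lemma clip_id (R : realType) (B x : R) : `|x| <= B -> clip B x = x.
Proof. by rewrite ler_norml => /andP[h1 h2]; rewrite /clip (min_r h2) (max_r h1). Qed.

Lemma clipN (R : realType) (B x : R) : 0 <= B -> clip B (- x) = - clip B x.
Proof.
move=> B0; have [h1|h1] := leP x (- B).
  rewrite /clip (min_r (_ : x <= B)) ?(max_l h1) ?(min_l (_ : B <= - x))
    ?max_r ?opprK//; lra.
have [h2|h2] := leP B x.
  rewrite /clip (min_l h2) (min_r (_ : - x <= B)) ?(max_l (_ : - x <= - B)) ?max_r//; lra.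
have xB : `|x| <= B by rewrite ler_norml !ltW.
by rewrite !clip_id// normrN.
Qed.

Lemma clip_bound (R : realType) (B x : R) : 0 <= B -> `|clip B x| <= B.
Proof.
by move=> B0; rewrite ler_norml /clip le_max lexx/= ge_max ge_min lexx andbT; lra.
Qed.

Lemma clip_lipschitz (R : realType) (B x y : R) : `|clip B x - clip B y| <= `|x - y|.
Proof.
have H (u v : R) : clip B u - clip B v <= `|u - v|.
  rewrite lerBlDr /clip ge_max; apply/andP; split.
    by apply: ler_wpDl => //; rewrite le_max lexx.
  have [h|h] := leP B v.
    rewrite ge_min; apply/orP; left; apply: ler_wpDl => //.
    by rewrite le_max lexx orbT.
  rewrite ge_min; apply/orP; right.
  rewrite -lerBlDl; apply: (@le_trans _ _ v); last by rewrite le_max lexx orbT.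
  by rewrite lerBlDl -lerBlDr ler_norm.
by rewrite ler_norml H andbT lerNl opprB distrC.
Qed.

Section exponential_moments.
Context (R : realType) (dOm : measure_display) (Om : measurableType dOm)
  (P : probability Om R).

Lemma expectation_gt0 (g : Om -> R) : L1 P g -> (forall w, 0 < g w) ->
  0 < \int[P]_w g w.
Proof.
move=> lg g0; rewrite lt_def Rintegral_ge0 ?andbT => [|w _]; last exact: ltW.
apply/negP => /eqP Ig.
have mg := L1_measurable lg.
have : (\int[P]_w `|(g w)%:E| = 0)%E.
  under eq_integral do rewrite gee0_abs ?lee_fin ?ltW//.
  by rewrite -EFin_Rintegral// Ig.
move=> /(ae_eq_integral_abs P measurableT) H.
have /H [N [mN PN0 sN]] : measurable_fun setT (EFin \o g) by exact/measurable_EFinP.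
have NT : N = setT.
  apply/seteqP; split => // w _; apply: sN => /= /(_ I) [] gw.
  by move: (g0 w); rewrite gw ltxx.
have := probability_setT P; rewrite -NT PN0 => /eqP.
by rewrite eqe eq_sym oner_eq0.
Qed.

Section clipped.
Context (f : Om -> R).
Hypothesis mf : measurable_fun setT f.

Let mexp (g : Om -> R) :
  measurable_fun setT g -> measurable_fun setT (fun w => expR (g w)).
Proof. by move=> mg; apply: measurableT_comp. Qed.

Let mclip B : measurable_fun setT (fun w => clip B (f w)).
Proof. by apply: measurable_maxr => //; apply: measurable_minr. Qed.

Let L1clip B : 0 <= B -> L1 P (fun w => expR (clip B (f w))).
Proof.
move=> B0; apply: (@L1_bounded _ _ _ _ _ (expR B)) => [|w]; first exact: mexp.
rewrite ger0_norm ?expR_ge0// ler_expR.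
exact: le_trans (ler_norm _) (clip_bound _ B0).
Qed.

Let L1clipN B : 0 <= B -> L1 P (fun w => expR (- clip B (f w))).
Proof.
move=> B0; apply: (@L1_bounded _ _ _ _ _ (expR B)) => [|w].
  by apply: mexp; exact: measurable_funN.
rewrite ger0_norm ?expR_ge0// ler_expR.
by apply: le_trans (ler_norm _) _; rewrite normrN clip_bound.
Qed.

(** The second factor of the product is bounded below, uniformly in the clipping
    level, by the expectation of exp(- max(0, f)), so the first one is bounded;
    monotone convergence then removes the clipping from above. *)
Lemma L1_exp_of_clipped (C : R) :
  (forall k : nat, (\int[P]_w expR (clip k%:R (f w))) *
     (\int[P]_w expR (- clip k%:R (f w))) <= C) ->
  L1 P (fun w => expR (f w)).
Proof.
move=> HC.
pose g w := expR (- Num.max 0 (f w)).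
have Lg : L1 P g.
  apply: (@L1_bounded _ _ _ _ _ 1) => [|w].
    by apply: mexp; apply: measurable_funN; exact: measurable_maxr.
  by rewrite ger0_norm ?expR_ge0// -expR0 ler_expR oppr_le0 le_max lexx.
have c0 : 0 < \int[P]_w g w by apply: expectation_gt0 => // w; exact: expR_gt0.
set c := \int[P]_w g w in c0 *.
have bound (k : nat) : \int[P]_w expR (clip k%:R (f w)) <= C / c.
  rewrite ler_pdivlMr//; apply: le_trans (HC k); apply: ler_wpM2l.
    by apply: Rintegral_ge0 => w _; exact: expR_ge0.
  apply: le_expectation => [//||w]; first exact: L1clipN.
  rewrite ler_expR lerN2 /clip ge_max; apply/andP; split.
    by rewrite le_max oppr_le0 ler0n.
  by rewrite ge_min !le_max lexx !orbT.
apply/integrableP; split; first by apply/measurable_EFinP; exact: mexp.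
under eq_integral do rewrite /= ger0_norm ?expR_ge0//.
apply: (@le_lt_trans _ _ (C / c)%:E); last exact: ltry.
pose h (k : nat) w : \bar R := (expR (Num.min k%:R (f w)))%:E.
have mh k : measurable_fun setT (h k).
  by apply/measurable_EFinP; apply: mexp; exact: measurable_minr.
have h0 k w : setT w -> (0 <= h k w)%E by move=> _; rewrite lee_fin expR_ge0.
have ndh w : setT w -> nondecreasing_seq (h ^~ w).
  move=> _ k l kl; rewrite lee_fin ler_expR le_min !ge_min lexx orbT andbT.
  by rewrite ler_nat kl.
have := @cvg_monotone_convergence _ _ _ P _ measurableT _ mh h0 ndh.
have -> : (\int[P]_(x in setT) limn (h^~ x))%E = (\int[P]_w (expR (f w))%:E)%E.
  apply: eq_integral => w _; apply/cvg_lim => //.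
  apply: cvg_near_cst.
  have [k fk] : exists k : nat, f w <= k%:R.
    exists (Num.truncn `|f w|).+1.
    by apply: le_trans (ler_norm _) (ltW (truncnS_gt _)).
  exists k => // l /= kl; rewrite /h min_r//.
  by apply: le_trans fk _; rewrite ler_nat.
move=> cv; apply: (cvge_to_le cv); apply: nearW => k.
apply: (@le_trans _ _ (\int[P]_w (expR (clip k%:R (f w)))%:E)%E).
  apply: ge0_le_integral => //; try exact: h0.
  - by apply/measurable_EFinP; exact: mexp.
  - by move=> w _; rewrite lee_fin ler_expR /clip le_max lexx orbT.
by rewrite -EFin_Rintegral ?lee_fin ?bound//; exact: L1clip.
Qed.

End clipped.

Lemma exp_product_of_clipped (f : Om -> R) (C : R) :
  measurable_fun setT f ->
  (forall k : nat, (\int[P]_w expR (clip k%:R (f w))) *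
     (\int[P]_w expR (- clip k%:R (f w))) <= C) ->
  [/\ L1 P (fun w => expR (f w)), L1 P (fun w => expR (- f w)) &
    (\int[P]_w expR (f w)) * (\int[P]_w expR (- f w)) <= C].
Proof.
move=> mf HC.
have mNf : measurable_fun setT (fun w => - f w) by exact: measurable_funN.
have L1p := L1_exp_of_clipped mf HC.
have L1n : L1 P (fun w => expR (- f w)).
  apply: (@L1_exp_of_clipped _ mNf C) => k.
  rewrite mulrC; apply: le_trans (HC k).
  under eq_Rintegral do rewrite clipN ?ler0n// opprK.
  by under [X in _ * X <= _]eq_Rintegral do rewrite clipN ?ler0n//.
split => //.
have cv (s : bool) : \int[P]_w expR ((-1) ^+ s * clip k%:R (f w)) @[k --> \oo] -->
    \int[P]_w expR ((-1) ^+ s * f w).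
  apply: (dominated_expectation (g := fun w => expR (f w) + expR (- f w))).
  - move=> k; apply: measurableT_comp => //; apply: measurable_funM => //.
    by apply: measurable_maxr => //; exact: measurable_minr.
  - by apply: measurableT_comp => //; exact: measurable_funM.
  - apply: aeW => w; apply: cvg_near_cst.
    exists (Num.truncn `|f w|).+1 => // k /= kl; rewrite clip_id//.
    by apply: le_trans (ltW (truncnS_gt _)) _; rewrite ler_nat.
  - exact: L1D.
  - move=> k w; rewrite ger0_norm ?expR_ge0//.
    have : (-1) ^+ s * clip k%:R (f w) <= `|f w|.
      apply: le_trans (ler_norm _) _; rewrite normrMsign.
      have := clip_lipschitz k%:R (f w) 0.
      by rewrite (@clip_id _ _ 0) ?normr0 ?ler0n// !subr0.
    rewrite -ler_expR => H; apply: le_trans H _.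
    have [f0|f0] := ger0P (f w).
      by rewrite lerDl expR_ge0.
    by rewrite lerDr expR_ge0.
have cvp := cv false; have cvn := cv true.
rewrite expr0 expr1 in cvp cvn.
have Ep : \int[P]_w expR (1 * f w) = \int[P]_w expR (f w).
  by apply: eq_Rintegral => w _; rewrite mul1r.
have En : \int[P]_w expR (-1 * f w) = \int[P]_w expR (- f w).
  by apply: eq_Rintegral => w _; rewrite mulN1r.
rewrite -Ep -En; apply: (cvgr_to_le (cvgM cvp cvn)); apply: nearW => k.
rewrite /=; apply: le_trans (HC k); rewrite le_eqVlt; apply/orP; left; apply/eqP.
by congr (_ * _); apply: eq_Rintegral => w _; rewrite ?mul1r ?mulN1r.
Qed.

(** exp(- E f) <= E[exp(- f)], because exp(- f) lies above its tangent line at the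
    mean of [f]. *)
Lemma centered_exp_moment (f : Om -> R) (C : R) :
  measurable_fun setT f ->
  L1 P (fun w => expR (f w)) -> L1 P (fun w => expR (- f w)) ->
  (\int[P]_w expR (f w)) * (\int[P]_w expR (- f w)) <= C ->
  L1 P f /\ ('E_P[fun w => expR (f w - fine 'E_P[f])] <= C%:E)%E.
Proof.
move=> mf Lp Ln HC.
have Lf : L1 P f.
  apply: (le_integrable measurableT _ _ (L1D Lp Ln)).
    exact/measurable_EFinP.
  move=> w _; rewrite /= lee_fin [leRHS]ger0_norm ?addr_ge0 ?expR_ge0//.
  have := expR_ge1Dx (f w); have := expR_ge1Dx (- f w).
  have := expR_ge0 (f w); have := expR_ge0 (- f w).
  by have [] := ger0P (f w); lra.
split => //; rewrite unlock.
set E := fine _.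
have EE : E = \int[P]_w f w by [].
under eq_integral do rewrite expRD EFinM.
have Lc : L1 P (fun w => expR (- E) * expR (f w)) by exact: L1Z.
rewrite (_ : (\int[P]_w ((expR (f w))%:E * (expR (- E))%:E))%E =
   (\int[P]_w (expR (- E) * expR (f w)))%:E); last first.
  by rewrite EFin_Rintegral//; apply: eq_integral => w _; rewrite -EFinM mulrC.
rewrite lee_fin RintegralZl// mulrC; apply: le_trans HC; apply: ler_wpM2l.
  by apply: Rintegral_ge0 => w _; exact: expR_ge0.
have LfE : L1 P (fun w => 1 + (E + -1 * f w)).
  by apply: L1D; [exact: L1_cst|apply: L1D; [exact: L1_cst|exact: L1Z]].
have -> : expR (- E) = \int[P]_w (expR (- E) * (1 + (E + -1 * f w))).
  rewrite RintegralZl// RintegralD//; last 2 first.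
  - exact: L1_cst.
  - by apply: L1D; [exact: L1_cst|exact: L1Z].
  rewrite RintegralD//; last 2 first.
  - exact: L1_cst.
  - exact: L1Z.
  by rewrite RintegralZl// !Rintegral_probability_cst -EE mulN1r subrr addr0 mulr1.
apply: le_expectation => //; first exact: L1Z.
move=> w; have -> : - f w = - E + (E - f w) by ring.
by rewrite expRD ler_wpM2l ?expR_ge0// mulN1r expR_ge1Dx.
Qed.

End exponential_moments.

(** * Concentration of Lipschitz functionals of the samples *)

Section gauge_concentration.
Context (R : realType) (d n : nat) (b : 'rV[R]_d -> 'rV[R]_d) (L M : R).
Local Notation state := ('I_n -> 'rV[R]_d).
Hypothesis M0 : 0 < M.
Hypothesis bL : lipschitz_wrt (@l2dist R d) (@l2dist R d) L b.
Hypothesis bM : forall x y, M * l2norm (x - y) ^+ 2 <= dotp (b x - b y) (x - y).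
Context (dOm : measure_display) (Om : measurableType dOm)
  (P : probability Om R) (W X : R -> Om -> 'rV[R]_d).
Hypothesis hW : brownian_motion P W.
Hypothesis hX : sde_solution P b W X.
Hypothesis hX0 : indep_sigma P (sigma_process [set 0] X)
             (sigma_process `[0, +oo[ W).
Hypothesis hXs : stationary_process P X.
Context (Delta : R).
Hypothesis Delta0 : 0 < Delta.

Theorem gauge_concentration (Nm : ('I_n -> R) -> R) (Gam : R) (F : state -> R) :
  gauge Nm -> total_influence_le M Nm Delta Gam ->
  (forall s s', `|F s - F s'| <= Nm (fun i => l2dist (s i) (s' i))) ->
  let f := fun w => F (sampled X Delta 0 w) in
  L1 P f /\
  ('E_P[fun w => expR (f w - fine 'E_P[f])] <= (expR (d%:R ^+ 2 * Gam))%:E)%E.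
Proof.
move=> gNm hGam FN f.
have mX : is_process X by case: hX.
have mf : measurable_fun setT f.
  apply: (measurable_gauge_lipschitz gNm FN (Z := sampled X Delta 0)) => i j.
  by apply: mX; rewrite mulr_ge0 ?ler0n ?(ltW Delta0).
have [|Lp Ln HC] := @exp_product_of_clipped R _ Om P f (expR (d%:R ^+ 2 * Gam)) mf.
  move=> k.
  apply: (@bounded_concentration R d n b L M M0 bL bM _ Om P W X hW hX hX0 hXs Nm Delta
    gNm Delta0 k%:R Gam (fun s => clip k%:R (F s))) => //.
  split=> [s|s s']; first exact: clip_bound.
  exact: le_trans (clip_lipschitz _ _ _) (FN s s').
exact: centered_exp_moment.
Qed.

End gauge_concentration.

(** * Sums of influences *)

Section influence_sums.
Context (R : realType).

(** A geometric sum. The induction carries the bound rho^(m - J), with truncated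
    subtraction: as long as J < m, the term of index J is the increment of that
    bound, and afterwards neither side changes. *)
Lemma past_weights_sum (rho : R) (m J : nat) : 0 <= rho -> rho <= 1 ->
  (1 - rho) * \sum_(j < J) (if (j < m)%N then rho ^+ (m - j.+1) else 0) <= 1.
Proof.
move=> r0 r1.
suff : (1 - rho) * \sum_(j < J) (if (j < m)%N then rho ^+ (m - j.+1) else 0) <=
    rho ^+ (m - J).
  by move=> /le_trans; apply; exact: exprn_ile1.
elim: J => [|J IH]; first by rewrite big_ord0 mulr0 exprn_ge0.
rewrite big_ord_recr/= mulrDr.
case: ltnP => Jm; last first.
  rewrite mulr0 addr0; apply: le_trans IH _.
  have /eqP -> : (m - J.+1 == 0)%N by rewrite subn_eq0 leqW.
  have /eqP -> : (m - J == 0)%N by rewrite subn_eq0.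
  by [].
move: IH; rewrite -(subnSK Jm) exprS; set e := rho ^+ _; lra.
Qed.

(** The sampling steps that follow step [j] are N' apart, so their weights are
    dominated by a geometric sequence of ratio rho^N'. *)
Lemma future_weights_sum (rho : R) (n N' k j : nat) : 0 <= rho -> rho <= 1 ->
  (1 - rho ^+ N') * \sum_(i < n) (if (j < N' * (k + i.+1))%N
     then rho ^+ (N' * (k + i.+1) - j.+1) else 0) <= 1.
Proof.
move=> r0 r1; pose c i : R := if (j < N' * (k + i.+1))%N
     then rho ^+ (N' * (k + i.+1) - j.+1) else 0.
rewrite (eq_bigr (fun i : 'I_n => c i))//.
have S0 l : (N' * (k + l) <= j)%N -> \sum_(i < l) c i = 0.
  move=> jl; apply: big1 => i _; rewrite /c ltnNge (leq_trans _ jl)//.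
  by rewrite leq_mul2l leq_add2l ltn_ord orbT.
have claim l : (j < N' * (k + l.+1))%N ->
    (1 - rho ^+ N') * \sum_(i < l) c i + rho ^+ (N' * (k + l.+1) - j.+1) <= 1.
  elim: l => [|l IH] jl; first by rewrite big_ord0 mulr0 add0r exprn_ile1.
  have [jl'|lj] := ltnP j (N' * (k + l.+1)); last first.
    by rewrite S0// mulr0 add0r exprn_ile1.
  rewrite big_ord_recr/= [c l]/c jl'.
  have -> : (N' * (k + l.+2) - j.+1 = N' + (N' * (k + l.+1) - j.+1))%N.
    by rewrite addnBA// -mulnS -addnS.
  rewrite exprD; have := IH jl'; lra.
have [jl|lj] := ltnP j (N' * (k + n.+1)).
  apply: le_trans (claim n jl); rewrite lerDl exprn_ge0//.
rewrite S0 ?mulr0// (leq_trans _ lj)//.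
by rewrite leq_mul2l leq_add2l leqnSn orbT.
Qed.

Definition l2_gauge (n : nat) (kappa : R) (u : 'I_n -> R) : R :=
  kappa * Num.sqrt (\sum_i u i ^+ 2).

Definition l1_gauge (n : nat) (kappa : R) (u : 'I_n -> R) : R :=
  kappa * \sum_i u i.

Lemma gauge_l2 n (kappa : R) : 0 <= kappa -> gauge (@l2_gauge n kappa).
Proof.
move=> k0; split=> [u v uv|c u c0].
  rewrite ler_wpM2l// ler_sqrt; last by rewrite sumr_ge0// => i _; rewrite sqr_ge0.
  apply: ler_sum => i _; have /andP[u0 uvi] := uv i.
  by rewrite ler_sqr ?nnegrE// (le_trans u0).
rewrite /l2_gauge mulrCA; congr (_ * _).
under eq_bigr do rewrite exprMn.
by rewrite -mulr_sumr sqrtrM ?sqr_ge0// sqrtr_sqr ger0_norm.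
Qed.

Lemma gauge_l1 n (kappa : R) : 0 <= kappa -> gauge (@l1_gauge n kappa).
Proof.
move=> k0; split=> [u v uv|c u c0].
  by rewrite ler_wpM2l// ler_sum// => i _; have /andP[] := uv i.
by rewrite /l1_gauge -mulr_sumr mulrCA.
Qed.

Section total.
Context (M Delta : R) (n : nat) (kappa : R).
Hypothesis M0 : 0 < M.
Hypothesis Delta0 : 0 < Delta.
Let weight N k (i : 'I_n) (j : nat) : R :=
  if (j < N.+1 * (k + i.+1))%N
  then (1 - M * (Delta / N.+1%:R) / 2) ^+ (N.+1 * (k + i.+1) - j.+1) else 0.

Section fine_step.
Context (N : nat).
Local Notation h := (Delta / N.+1%:R).
Local Notation rho := (1 - M * h / 2).
Hypothesis hM : M * h <= 2.

Let h0 : 0 < h. Proof. by rewrite divr_gt0. Qed.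
Let rho0 : 0 <= rho. Proof. by rewrite subr_ge0 ler_pdivrMr// mul1r. Qed.
Let rho1 : rho <= 1. Proof. by rewrite gerBl divr_ge0 ?mulr_ge0 ?ltW. Qed.

Lemma weight_ge0 k i j : 0 <= weight N k i j.
Proof. by rewrite /weight; case: ifP => // _; exact: exprn_ge0. Qed.

Lemma weight_le1 k i j : weight N k i j <= 1.
Proof. by rewrite /weight; case: ifP => // _; exact: exprn_ile1. Qed.

Lemma sum_weights J k : h * \sum_(j < J) \sum_i weight N k i j <= n%:R * (2 / M).
Proof.
rewrite exchange_big/= mulr_sumr.
rewrite [leRHS](_ : _ = \sum_(i < n) 2 / M); last first.
  by rewrite sumr_const card_ord mulr_natl.
apply: ler_sum => i _.
have := past_weights_sum (N.+1 * (k + i.+1)) J rho0 rho1.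
rewrite -/(weight N k i _); set S := \sum_(j < J) _ => H.
rewrite ler_pdivlMr//; move: H; rewrite opprB addrC subrK.
rewrite -(ler_pM2r (ltr0Sn R 1)) mul1r; apply: le_trans.
by rewrite le_eqVlt; apply/orP; left; apply/eqP; rewrite /S; field.
Qed.

Lemma sum_weights_time k j :
  \sum_i weight N k i j <= (1 - expR (- (M * Delta / 2)))^-1.
Proof.
have := future_weights_sum n N.+1 k j rho0 rho1.
have qr : rho ^+ N.+1 <= expR (- (M * Delta / 2)).
  have := @contraction_le_expR R M Delta N 1 1 hM (leqnn _).
  by rewrite muln1 mulr1; apply; rewrite mulr_ge0 ?ltW.
have q1 : 0 < 1 - expR (- (M * Delta / 2)).
  by rewrite subr_gt0 -expR0 ltr_expR oppr_lt0 divr_gt0// mulr_gt0.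
rewrite -[X in _ -> _ <= X]mul1r ler_pdivlMr// mulrC => H.
apply: le_trans H; apply: ler_wpM2l; last by rewrite lerB.
by apply: sumr_ge0 => i _; exact: weight_ge0.
Qed.

End fine_step.

(** A weight is at most one, hence larger than its square, and each sampling time
    collects at most h / (1 - rho) = 2 / M from all the noises that precede it. *)
Lemma total_influence_l2 :
  total_influence_le M (@l2_gauge n kappa) Delta (kappa ^+ 2 * (n%:R * (2 / M))).
Proof.
have [N1 HN1] := small_enough_steps 0 M0 Delta0.
exists N1 => N k /HN1[_ hM].
have h0 : 0 < Delta / N.+1%:R by rewrite divr_gt0.
apply: le_trans (ler_wpM2l (sqr_ge0 kappa) (sum_weights hM (N.+1 * (k + n)) k)).
rewrite [leRHS]mulrCA -mulr_sumr ler_pM2l// mulr_sumr; apply: ler_sum => j _.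
rewrite /influence /l2_gauge exprMn sqr_sqrtr; last first.
  by apply: sumr_ge0 => i _; exact: sqr_ge0.
rewrite ler_wpM2l ?sqr_ge0// ler_sum// => i _.
rewrite -/(weight N k i j) expr2 ler_piMl//; [exact: weight_ge0|exact: weight_le1].
Qed.

(** One of the two factors of the square of the sum of the weights is bounded by
    the sum over all later sampling times, the other one summed as for the
    Euclidean gauge. *)
Lemma total_influence_l1 :
  total_influence_le M (@l1_gauge n kappa) Delta
    (kappa ^+ 2 * (n%:R * (2 / M)) / (1 - expR (- (M * Delta / 2)))).
Proof.
have [N1 HN1] := small_enough_steps 0 M0 Delta0.
exists N1 => N k /HN1[_ hM].
have h0 : 0 < Delta / N.+1%:R by rewrite divr_gt0.
have q1 : 0 < 1 - expR (- (M * Delta / 2)).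
  by rewrite subr_gt0 -expR0 ltr_expR oppr_lt0 divr_gt0// mulr_gt0.
rewrite [leRHS]mulrAC.
have c0 : 0 <= kappa ^+ 2 / (1 - expR (- (M * Delta / 2))).
  by rewrite divr_ge0 ?sqr_ge0// ltW.
apply: le_trans (ler_wpM2l c0 (sum_weights hM (N.+1 * (k + n)) k)).
rewrite [leRHS]mulrCA -mulr_sumr ler_pM2l// mulr_sumr; apply: ler_sum => j _.
rewrite /influence /l1_gauge exprMn -[leRHS]mulrA ler_wpM2l ?sqr_ge0//.
rewrite expr2 ler_wpM2r//.
  by apply: sumr_ge0 => i _; exact: weight_ge0.
exact: sum_weights_time.
Qed.

End total.
End influence_sums.

(** * Lipschitz constants and rates *)

Section lip_norm.
Context (R : realType) (U : Type) (dU : U -> U -> R) (F : U -> R).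
Hypothesis dU_ge0 : forall x y, 0 <= dU x y.
Hypothesis dU_eq0 : forall x y, dU x y = 0 -> x = y.
Hypothesis lipF : is_lipschitz dU F.

Let quotients := [set r | exists x y, x <> y /\ r = `|F x - F y| / dU x y].

Let has_ubound_quotients : has_ubound quotients.
Proof.
have [K HK] := lipF; exists K => _ [x [y [xy ->]]].
have dxy : 0 < dU x y.
  by rewrite lt_def dU_ge0 andbT; apply/eqP => /dU_eq0.
by rewrite ler_pdivrMr//; exact: HK.
Qed.

Lemma lip_norm_ge0 : 0 <= lip_norm dU F.
Proof.
have [q0|/set0P[r qr]] := eqVneq quotients set0.
  by rewrite /lip_norm -[X in sup X]/quotients q0 sup0.
have [x [y [_ rE]]] := qr.
apply: (@le_trans _ _ r); first by rewrite rE divr_ge0.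
by apply: sup_upper_bound => //; split => //; exists r.
Qed.

Lemma le_lip_norm x y : `|F x - F y| <= lip_norm dU F * dU x y.
Proof.
have [->|xy] := pselect (x = y).
  by rewrite subrr normr0 mulr_ge0// lip_norm_ge0.
have dxy : 0 < dU x y.
  by rewrite lt_def dU_ge0 andbT; apply/eqP => /dU_eq0.
rewrite -ler_pdivrMr//; apply: sup_upper_bound.
  by split => //; exists (`|F x - F y| / dU x y), x, y.
by exists x, y.
Qed.

End lip_norm.

Lemma l2dist_eq0 (R : realType) (d : nat) (x y : 'rV[R]_d) : l2dist x y = 0 -> x = y.
Proof. by move=> /l2norm_eq0/eqP; rewrite subr_eq0 => /eqP. Qed.

Lemma dist_n_ge0 (R : realType) (d n : nat) (x y : 'I_n -> 'rV[R]_d) : 0 <= dist_n x y.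
Proof. exact: sqrtr_ge0. Qed.

Lemma l2dist_le_dist_n (R : realType) (d n : nat) (x y : 'I_n -> 'rV[R]_d) i :
  l2dist (x i) (y i) <= dist_n x y.
Proof.
have S0 (P : pred 'I_n) : 0 <= \sum_(j | P j) l2dist (x j) (y j) ^+ 2.
  by apply: sumr_ge0 => j _; exact: sqr_ge0.
rewrite -[leLHS]ger0_norm ?l2dist_ge0// -sqrtr_sqr ler_sqrt//.
by rewrite (bigD1 i)//= lerDl.
Qed.

Lemma dist_n_eq0 (R : realType) (d n : nat) (x y : 'I_n -> 'rV[R]_d) :
  dist_n x y = 0 -> x = y.
Proof.
move=> xy; apply/funext => i; apply: l2dist_eq0; apply/eqP.
by rewrite eq_le l2dist_ge0 andbT -xy l2dist_le_dist_n.
Qed.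

Section constants.
Context (R : realType) (M Delta : R).
Hypothesis M0 : 0 < M.
Hypothesis Delta0 : 0 < Delta.
Local Notation y := (1 - expR (- (M * Delta))).

Lemma rate_gt0 : 0 < y.
Proof. by rewrite subr_gt0 -expR0 ltr_expR oppr_lt0 mulr_gt0. Qed.

Lemma rate_le : y <= M * Delta.
Proof. by rewrite lerBlDl -lerBlDr; have := expR_ge1Dx (- (M * Delta)); lra. Qed.

(** Both y <= M Delta and y <= 1 hold for y = 1 - exp(- M Delta). *)
Lemma l2_rate_bound : 2 / M <= 16 * Delta / y ^+ 2.
Proof.
have y0 := rate_gt0; have yM := rate_le.
have y1 : y <= 1 by have := expR_ge0 (- (M * Delta)); lra.
rewrite ler_pdivlMr ?exprn_gt0// mulrAC ler_pdivrMr//; move: y y0 yM y1 => t t0 tM t1.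
have : t ^+ 2 <= t by rewrite expr2 ler_piMl// ltW.
have : 0 < M * Delta by exact: mulr_gt0.
lra.
Qed.

(** With q = exp(- M Delta / 2), the factorization y = (1 - q) (1 + q) gives
    y^2 <= M Delta * 2 (1 - q). *)
Lemma l1_rate_bound :
  2 / M / (1 - expR (- (M * Delta / 2))) <= 16 * Delta / y ^+ 2.
Proof.
have y0 := rate_gt0; have yM := rate_le.
set q := expR (- (M * Delta / 2)).
have yq : y = (1 - q) * (1 + q).
  have -> : expR (- (M * Delta)) = q * q by rewrite -expRD; congr expR; field.
  by ring.
have q0 : 0 < q by exact: expR_gt0.
have q1 : 0 < 1 - q.
  by rewrite subr_gt0 /q -expR0 ltr_expR oppr_lt0 divr_gt0// mulr_gt0.
rewrite ler_pdivlMr ?exprn_gt0// ![_ * y ^+ 2]mulrAC ler_pdivrMr// ler_pdivrMr//.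
have qle1 : 1 + q <= 2 by lra.
have y2 : y ^+ 2 <= M * Delta * ((1 - q) * 2).
  rewrite expr2 ler_pM ?(ltW y0)// {}yq ler_wpM2l// ltW//.
have MD : 0 < M * Delta * (1 - q) by rewrite !mulr_gt0.
move: (y ^+ 2) y2 => z y2; lra.
Qed.

End constants.

(** In dimension zero every real number is a Lipschitz constant. *)
Lemma lipschitz_const_ge0 (R : realType) (d : nat) (b : 'rV[R]_d -> 'rV[R]_d) (L : R) :
  (0 < d)%N -> lipschitz_wrt (@l2dist R d) (@l2dist R d) L b -> 0 <= L.
Proof.
case: d b => // d b _ bL.
have H := le_trans (l2dist_ge0 _ _) (bL (const_mx 1) 0).
have xy : 0 < l2dist (const_mx 1 : 'rV[R]_d.+1) 0.
  rewrite lt_def l2dist_ge0 andbT; apply/eqP => /l2dist_eq0 /rowP /(_ 0).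
  by rewrite !mxE => /eqP; rewrite oner_eq0.
by rewrite -(pmulr_lge0 _ xy).
Qed.

(** * The concentration inequalities *)

Lemma fine_expectationZ (R : realType) (dOm : measure_display)
    (Om : measurableType dOm) (P : probability Om R) (r : R) (f : Om -> R) :
  L1 P f -> fine 'E_P[fun w => r * f w] = r * fine 'E_P[f].
Proof. by move=> lf; rewrite unlock; exact: RintegralZl. Qed.

(** The factor exp(4 L Delta) is at least one as soon as [L] is nonnegative; in
    dimension zero, where this may fail, both sides vanish. *)
Lemma concentration_rate (R : realType) (d : nat) (L Delta : R) (c u v : R) :
  ((0 < d)%N -> 0 <= L) -> 0 <= Delta -> 0 <= c -> 0 <= u -> u <= v ->
  d%:R ^+ 2 * (c * u) <= d%:R ^+ 2 * expR (4 * L * Delta) * (c * v).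
Proof.
move=> L0 D0 c0 u0 uv; apply: ler_pM; rewrite ?exprn_ge0 ?mulr_ge0 ?ler0n//.
  case: d L0 => [|d] L0; first by rewrite expr0n/= mul0r.
  rewrite ler_peMr ?exprn_ge0// -expR0 ler_expR !mulr_ge0//; exact: L0.
by rewrite ler_wpM2l.
Qed.

Lemma measurable_superlevel (R : realType) (dOm : measure_display)
    (Om : measurableType dOm) (S : Om -> R) (r : R) :
  measurable_fun setT S -> measurable [set w | r < S w].
Proof.
move=> mS; have := mS measurableT `]r, +oo[%classic (measurable_itv _).
rewrite setTI; congr measurable.
by apply/seteqP; split => w /=; rewrite in_itv/= andbT.
Qed.

(** Chernoff's bound with the optimal choice eta = r / (2 A). *)
Lemma chernoff_of_subgaussian (R : realType) (dOm : measure_display)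
    (Om : measurableType dOm) (P : probability Om R) (S : Om -> R) (A r : R) :
  measurable_fun setT S -> 0 < A -> 0 < r ->
  (forall eta, 0 < eta ->
     ('E_P[fun w => expR (eta * S w)] <= (expR (eta ^+ 2 * A))%:E)%E) ->
  (P [set w | (r < S w)%R] <= (expR (- (r ^+ 2 / (4 * A))))%:E)%E.
Proof.
move=> mS A0 r0 HS.
pose SX : {RV P >-> R} := mfun_Sub (mem_set mS).
pose eta := r / (2 * A).
have eta0 : 0 < eta by rewrite divr_gt0// mulr_gt0.
have := chernoff SX r eta0; rewrite /mmt_gen_fun.
have -> : expR \o eta \o* SX = (fun w => expR (eta * S w)).
  by apply/funext => w /=; rewrite mulrC.
move=> H.
apply: (@le_trans _ _ (P [set x | SX x >= r])).
  apply: le_measure; rewrite ?inE.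
  - exact: measurable_superlevel.
  - have := mS measurableT `[r, +oo[%classic (measurable_itv _); rewrite setTI.
    congr measurable; apply/seteqP; split => w /=; by rewrite in_itv/= andbT.
  - by move=> w /=; exact: ltW.
apply: le_trans H _.
apply: (@le_trans _ _ ((expR (eta ^+ 2 * A))%:E * (expR (- (eta * r)))%:E)%E).
  by rewrite lee_wpmul2r ?lee_fin ?expR_ge0//; exact: HS.
rewrite -EFinM lee_fin -expRD ler_expR le_eqVlt; apply/orP; left; apply/eqP.
by rewrite /eta; field; rewrite gt_eqF.
Qed.

Theorem proposition3p1 (R : realType) (K M : R) (hM : 0 < M)
    (d p n : nat) (hn : (0 < n)%N)
    (phi : 'I_p.+1 -> 'rV[R]_d -> 'rV[R]_d)
    (Theta : set 'rV[R]_p) (theta0 : 'rV[R]_p)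
    (hThetac : compact Theta) (hThetav : convex_set (Theta : set (convex_lmodType 'rV[R]_p)))
    (htheta0 : Theta theta0)
    (hphi : forall j, lipschitz_wrt (@l2dist R d) (@l2dist R d) K (phi j))
    (L : R)
    (hL : lipschitz_wrt (@l2dist R d) (@l2dist R d) L (drift phi theta0))
    (hb : forall (x y : 'rV[R]_d) (theta : 'rV[R]_p), Theta theta ->
       M * l2norm (x - y) ^+ 2 <=
       dotp (drift phi theta x - drift phi theta y) (x - y))
    (dOm : measure_display) (Om : measurableType dOm) (P : probability Om R)
    (W X : R -> Om -> 'rV[R]_d)
    (hW : brownian_motion P W)
    (hX : sde_solution P (drift phi theta0) W X)
    (hX0 : indep_sigma P (sigma_process [set 0] X)
             (sigma_process `[0, +oo[ W))
    (hXe : ergodic_process P X)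
    (T : R) (hT : 0 < T) :
  let Delta := T / n%:R in
  let t := fun i : 'I_n => i.+1%:R * Delta in
  (forall F : ('I_n -> 'rV[R]_d) -> R, is_lipschitz (@dist_n R d n) F ->
     let FX := fun w : Om => F (fun i => X (t i) w) in
     forall eta : R, 0 < eta ->
     ('E_P[fun w => expR (eta * (FX w - fine 'E_P[FX]))] <=
      (expR (16 * eta ^+ 2 * d%:R ^+ 2 * lip_norm (@dist_n R d n) F ^+ 2 *
               (n%:R * Delta) * expR (4 * L * Delta) /
             (1 - expR (- (M * Delta))) ^+ 2))%:E)%E)
  /\
  (forall f : 'rV[R]_d -> R, is_lipschitz (@l2dist R d) f ->
     let S := fun w : Om =>
       n%:R^-1 * \sum_(i < n)
         (f (X (t i) w) - fine 'E_P[fun w' => f (X (t i) w')]) in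
     (forall eta : R, 0 < eta ->
        ('E_P[fun w => expR (eta * S w)] <=
         (expR (16 * eta ^+ 2 * d%:R ^+ 2 * lip_norm (@l2dist R d) f ^+ 2 *
                  Delta * expR (4 * L * Delta) /
                (n%:R * (1 - expR (- (M * Delta))) ^+ 2)))%:E)%E)
     /\
     (forall r : R, 0 < r ->
        (P [set w | (r < S w)%R] <=
         (expR (- (r ^+ 2 * n%:R * (1 - expR (- (M * Delta))) ^+ 2) /
                (64 * d%:R ^+ 2 * lip_norm (@l2dist R d) f ^+ 2 *
                   Delta * expR (4 * L * Delta))))%:E)%E)).
Proof.
move=> Delta t.
have n0 : (0 : R) < n%:R by rewrite ltr0n.
have D0 : 0 < Delta by rewrite divr_gt0.
have bM x y := hb x y theta0 htheta0.
have L0 (d0 : (0 < d)%N) := lipschitz_const_ge0 d0 hL.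
have y0 := rate_gt0 hM D0.
have conc := @gauge_concentration R d n (drift phi theta0) L M hM hL bM _ Om P W X
  hW hX hX0 hXe.1 Delta D0.
split=> [F lipF FX eta eta0|f lipf S].
  set kF := lip_norm _ F.
  have kF0 : 0 <= kF := lip_norm_ge0 (@dist_n_ge0 R d n) (@dist_n_eq0 R d n) lipF.
  have kappa0 : 0 <= eta * kF by rewrite mulr_ge0// ltW.
  have [s s'|LG EG] := @conc _ _ (fun s => eta * F s) (gauge_l2 n kappa0)
    (@total_influence_l2 R M Delta n _ hM D0).
    rewrite -mulrBr normrM (gtr0_norm eta0) /l2_gauge -mulrA ler_wpM2l ?(ltW eta0)//.
    exact: (le_lip_norm (@dist_n_ge0 R d n) (@dist_n_eq0 R d n) lipF).
  have LF : L1 P FX.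
    have := L1Z eta^-1 LG; congr L1; apply/funext => w.
    by rewrite mulKf// gt_eqF.
  apply: le_trans (le_trans _ EG) _.
    rewrite (fine_expectationZ eta LF) le_eqVlt; apply/orP; left; apply/eqP.
    by congr (expectation P _); apply/funext => w; rewrite mulrBr.
  rewrite lee_fin ler_expR.
  rewrite (_ : (eta * kF) ^+ 2 * _ = ((eta * kF) ^+ 2 * n%:R) * (2 / M)); last first.
    by rewrite [LHS]mulrA.
  apply: le_trans (concentration_rate L0 (ltW D0) _ _ (l2_rate_bound hM D0)) _.
  - by rewrite mulr_ge0 ?sqr_ge0// ltW.
  - by rewrite divr_ge0// ltW.
  - rewrite le_eqVlt; apply/orP; left; apply/eqP; field.
    by rewrite gt_eqF.
set kf := lip_norm _ f.
have kf0 : 0 <= kf := lip_norm_ge0 (@l2dist_ge0 R d) (@l2dist_eq0 R d) lipf.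
have kfP := le_lip_norm (@l2dist_ge0 R d) (@l2dist_eq0 R d) lipf.
have Lf (i : 'I_n) : L1 P (fun w => f (X (t i) w)).
  have [s s'|//] := @conc _ _ (fun s => f (s i)) (gauge_l2 n kf0)
    (@total_influence_l2 R M Delta n _ hM D0).
  apply: le_trans (kfP _ _) _.
  by rewrite ler_wpM2l//; exact: (l2dist_le_dist_n s s' i).
pose A := 16 * d%:R ^+ 2 * kf ^+ 2 * Delta * expR (4 * L * Delta) /
  (n%:R * (1 - expR (- (M * Delta))) ^+ 2).
have ES eta : 0 < eta ->
    ('E_P[fun w => expR (eta * S w)] <= (expR (eta ^+ 2 * A))%:E)%E.
  move=> eta0.
  have kappa0 : 0 <= eta * kf / n%:R by rewrite divr_ge0 ?ler0n// mulr_ge0// ltW.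
  pose G (s : 'I_n -> 'rV[R]_d) := eta / n%:R * \sum_i f (s i).
  have [s s'|LG EG] := @conc _ _ G (gauge_l1 n kappa0)
    (@total_influence_l1 R M Delta n _ hM D0).
    rewrite /G -mulrBr -sumrB normrM ger0_norm; last by rewrite divr_ge0// ltW.
    rewrite /l1_gauge [eta * kf / _]mulrAC -[leRHS]mulrA ler_wpM2l ?divr_ge0 ?(ltW eta0)//.
    rewrite (le_trans (ler_norm_sum _ _ _))// mulr_sumr ler_sum// => i _.
  pose GX := fun w => G (sampled X Delta 0 w).
  rewrite -/GX in LG EG.
  have EGX : fine 'E_P[GX] = eta / n%:R * \sum_i fine 'E_P[fun w => f (X (t i) w)].
    rewrite (fine_expectationZ (eta / n%:R)); last exact: (L1_sum _ Lf).
    by rewrite unlock; congr (_ * _); exact: (Rintegral_sum _ Lf).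
  apply: le_trans (le_trans _ EG) _.
    rewrite EGX le_eqVlt; apply/orP; left; apply/eqP.
    congr (expectation P _); apply/funext => w; congr expR.
    by rewrite /S /GX /G -mulrBr -sumrB mulrA.
  rewrite lee_fin ler_expR.
  rewrite (_ : (eta * kf / n%:R) ^+ 2 * _ / _ = ((eta * kf) ^+ 2 / n%:R) *
    (2 / M / (1 - expR (- (M * Delta / 2))))); last first.
    by rewrite [RHS]mulrA; congr (_ / _); field; rewrite !gt_eqF.
  apply: le_trans (concentration_rate L0 (ltW D0) _ _ (l1_rate_bound hM D0)) _.
  - by rewrite divr_ge0 ?sqr_ge0.
  - rewrite divr_ge0 ?divr_ge0 ?(ltW hM)// ltW// subr_gt0 -expR0 ltr_expR.
    by rewrite oppr_lt0 divr_gt0// mulr_gt0.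
  - rewrite /A le_eqVlt; apply/orP; left; apply/eqP; field.
    by rewrite !gt_eqF.
split=> [eta eta0|r r0].
  apply: le_trans (ES eta eta0) _; rewrite lee_fin ler_expR le_eqVlt; apply/orP; left.
  by apply/eqP; rewrite /A; field; rewrite !gt_eqF.
have mS : measurable_fun setT S.
  apply: measurable_funM => //; apply: L1_measurable.
  apply: (L1_sum (P := P)) => i.
  have := L1D (Lf i) (L1_cst P (- fine 'E_P[fun w' => f (X (t i) w')])).
  by [].
have A0 : 0 <= A.
  by rewrite /A divr_ge0 ?mulr_ge0 ?exprn_ge0 ?expR_ge0 ?ler0n ?(ltW D0)//; exact: ltW.
have denE : 64 * d%:R ^+ 2 * kf ^+ 2 * Delta * expR (4 * L * Delta) =
    4 * A * (n%:R * (1 - expR (- (M * Delta))) ^+ 2).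
  by rewrite /A; field; rewrite !gt_eqF.
(* if A = 0, the exponent on the right is a quotient by zero, which is zero *)
have [A00|Apos] := eqVneq A 0.
  rewrite denE A00 mulr0 mul0r invr0 mulr0 expR0.
  by apply: probability_le1; exact: measurable_superlevel.
have {}Apos : 0 < A by rewrite lt_def Apos.
apply: le_trans (chernoff_of_subgaussian mS Apos r0 ES) _.
rewrite lee_fin ler_expR denE le_eqVlt; apply/orP; left; apply/eqP; field.
by rewrite !gt_eqF.
Qed.
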